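(* For any $\ell\in\mathbb N_0$ we have the following asymptotic expansions as $\nu\to\infty$: $$J_\nu^{(\ell)}(\nu+a\nu^{1/3})\sim\frac{2^{1/3}}{\nu^{(\ell+1)/3}}\sum_{k=0}^\infty\nu^{-2k/3}\frac{\partial^\ell}{\partial a^\ell}\bigl(P_k(a)\operatorname{Ai}(-2^{1/3}a)\bigr)+\frac{2^{2/3}}{\nu^{(\ell+3)/3}}\sum_{k=0}^\infty\nu^{-2k/3}\frac{\partial^\ell}{\partial a^\ell}\bigl(Q_k(a)\operatorname{Ai}'(-2^{1/3}a)\bigr),$$ $$Y_\nu^{(\ell)}(\nu+a\nu^{1/3})\sim-\frac{2^{1/3}}{\nu^{(\ell+1)/3}}\sum_{k=0}^\infty\nu^{-2k/3}\frac{\partial^\ell}{\partial a^\ell}\bigl(P_k(a)\operatorname{Bi}(-2^{1/3}a)\bigr)-\frac{2^{2/3}}{\nu^{(\ell+3)/3}}\sum_{k=0}^\infty\nu^{-2k/3}\frac{\partial^\ell}{\partial a^\ell}\bigl(Q_k(a)\operatorname{Bi}'(-2^{1/3}a)\bigr).$$ These expansions are valid uniformly for $a$ in any compact subset of $\mathbb R$, and in each, the error in any partial sum is $O(\nu^{-s})$, where $\nu^{-s}$ is the order of the next largest term in the expansion.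
   Context: $J_\nu^{(\ell)}(z)$ and $Y_\nu^{(\ell)}(z)$ denote the $\ell$-th derivatives with respect to the argument $z$, evaluated at $z=\nu+a\nu^{1/3}$. $\operatorname{Ai},\operatorname{Bi}$ are the Airy functions, and $\operatorname{Ai}'(-2^{1/3}a)$ means the derivative of $\operatorname{Ai}$ evaluated at $-2^{1/3}a$. $P_k,Q_k$ ($k\ge0$) are the polynomials of the classical transition-region expansions of Bessel functions (DLMF 10.19.8): they are the polynomials (uniquely determined, with $P_0=1$) such that for each fixed real $a$, as $\nu\to\infty$, $J_\nu(\nu+a\nu^{1/3})\sim\frac{2^{1/3}}{\nu^{1/3}}\operatorname{Ai}(-2^{1/3}a)\sum_k P_k(a)\nu^{-2k/3}+\frac{2^{2/3}}{\nu}\operatorname{Ai}'(-2^{1/3}a)\sum_kQ_k(a)\nu^{-2k/3}$ and $Y_\nu(\nu+a\nu^{1/3})\sim-\frac{2^{1/3}}{\nu^{1/3}}\operatorname{Bi}(-2^{1/3}a)\sum_k P_k(a)\nu^{-2k/3}-\frac{2^{2/3}}{\nu}\operatorname{Bi}'(-2^{1/3}a)\sum_kQ_k(a)\nu^{-2k/3}$. *)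

(* Defs.v *)
From Stdlib Require Import Reals Factorial.
From Coquelicot Require Import Coquelicot.
Open Scope R_scope.

(* x (x + 1) ... (x + n - 1) *)
Fixpoint rising (x : R) (n : nat) : R :=
  match n with
  | O => 1
  | S m => rising x m * (x + INR m)
  end.

(* 1 / Gamma(x) for every real x, by Euler's limit
   Gamma(x) = lim n! n^x / (x (x + 1) ... (x + n)).
   It vanishes at the poles 0, -1, -2, ... of Gamma. *)
Definition rGamma (x : R) : R :=
  real (Lim_seq (fun n => rising x (S n) / (INR (fact n) * Rpower (INR n) x))).

(* J_nu(z) = (z/2)^nu sum_k (-1)^k (z/2)^(2k) / (k! Gamma(nu + k + 1)),
   for real nu and z > 0 (for z <= 0, Rpower takes a junk value). *)
Definition BesselJ (nu z : R) : R :=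
  Rpower (z / 2) nu *
  PSeries (fun k => (-1) ^ k * rGamma (nu + INR k + 1) / INR (fact k)) ((z / 2) ^ 2).

Definition BesselY_quotient (nu z : R) : R :=
  (BesselJ nu z * cos (nu * PI) - BesselJ (- nu) z) / sin (nu * PI).

(* At integer order, where sin (nu * PI) = 0, the quotient is replaced by its
   limiting value in nu. *)
Definition BesselY (nu z : R) : R :=
  if Req_EM_T (sin (nu * PI)) 0
  then real (Lim (fun mu => BesselY_quotient mu z) nu)
  else BesselY_quotient nu z.

(* The Maclaurin series of the Airy functions: airy_f and airy_g solve
   w'' = x w with (w(0), w'(0)) = (1, 0) and (0, 1) respectively, and
   Ai(0) = 3^(-2/3) / Gamma(2/3), Ai'(0) = - 3^(-1/3) / Gamma(1/3),
   Bi(0) = sqrt 3 Ai(0), Bi'(0) = - sqrt 3 Ai'(0). *)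
Definition airy_f (x : R) : R :=
  PSeries (fun k => 3 ^ k * rising (1 / 3) k / INR (fact (3 * k))) (x ^ 3).

Definition airy_g (x : R) : R :=
  x * PSeries (fun k => 3 ^ k * rising (2 / 3) k / INR (fact (3 * k + 1))) (x ^ 3).

Definition Ai (x : R) : R :=
  Rpower 3 (- (2 / 3)) * rGamma (2 / 3) * airy_f x
  - Rpower 3 (- (1 / 3)) * rGamma (1 / 3) * airy_g x.

Definition Bi (x : R) : R :=
  sqrt 3 * (Rpower 3 (- (2 / 3)) * rGamma (2 / 3) * airy_f x
            + Rpower 3 (- (1 / 3)) * rGamma (1 / 3) * airy_g x).

Definition is_polynomial (f : R -> R) : Prop :=
  exists (n : nat) (c : nat -> R), forall x, f x = sum_n (fun k => c k * x ^ k) n.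

(* f 0 + ... + f (n - 1), so that the empty sum is allowed (sum_n f n has n + 1 terms) *)
Definition sum_lt (f : nat -> R) (n : nat) : R :=
  match n with
  | O => 0
  | S m => sum_n f m
  end.

(* The first N terms of the P-series plus the first M terms of the Q-series,
   each differentiated l times in a; w is Ai or Bi. *)
Definition transition_sum (P Q : nat -> R -> R) (w : R -> R) (l N M : nat)
    (nu a : R) : R :=
  Rpower 2 (1 / 3) / Rpower nu (INR (l + 1) / 3) *
    sum_lt (fun k => Rpower nu (- (2 * INR k / 3)) *
                     Derive_n (fun x => P k x * w (- Rpower 2 (1 / 3) * x)) l a) N
  + Rpower 2 (2 / 3) / Rpower nu (INR (l + 3) / 3) *
    sum_lt (fun k => Rpower nu (- (2 * INR k / 3)) *
                     Derive_n (fun x => Q k x * Derive w (- Rpower 2 (1 / 3) * x)) l a) M.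

(* The first omitted terms of the two series have orders nu^(-(l+1+2N)/3) and
   nu^(-(l+3+2M)/3); the larger of the two is nu^(-next_order l N M). *)
Definition next_order (l N M : nat) : R :=
  Rmin (INR (l + 1 + 2 * N) / 3) (INR (l + 3 + 2 * M) / 3).

(* F nu a ~ sgn * (P-series + Q-series) as nu -> +oo through the reals, uniformly
   for a in K: every partial sum has an error of the order of the next largest term. *)
Definition transition_expansion (P Q : nat -> R -> R) (w : R -> R) (sgn : R)
    (l : nat) (K : R -> Prop) (F : R -> R -> R) : Prop :=
  forall N M : nat, exists C : R,
    Rbar_locally p_infty (fun nu => forall a, K a ->
      Rabs (F nu a - sgn * transition_sum P Q w l N M nu a)
      <= C * Rpower nu (- next_order l N M)).

Definition transition_point (nu a : R) : R := nu + a * Rpower nu (1 / 3).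

(* The characterisation of the polynomials P_k, Q_k: expansions for each fixed a,
   with no uniformity in a (l = 0, and Derive_n f 0 is f). *)
Definition transition_polynomials (P Q : nat -> R -> R) : Prop :=
  (forall k, is_polynomial (P k)) /\
  (forall k, is_polynomial (Q k)) /\
  (forall a, P 0%nat a = 1) /\
  (forall a0,
     transition_expansion P Q Ai 1 0 (fun a => a = a0)
       (fun nu a => BesselJ nu (transition_point nu a))) /\
  (forall a0,
     transition_expansion P Q Bi (-1) 0 (fun a => a = a0)
       (fun nu a => BesselY nu (transition_point nu a))).

(* Main.v *)
(* With t = nu^(1/3), h = t^-2 and F_nu(a) = t B_nu(nu + a t), B = J or Y, Bessel's equation
   reads L_h F = (1 + a h)^2 F'' + h (1 + a h) F' + (2 a + a^2 h) F = 0, which is polynomial in h.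
   On a short interval the values of u at the two endpoints and L_h u control u and u'; on a
   compact interval finitely many such endpoints suffice, so pointwise bounds at these points
   become uniform, and the differentiated equation passes them on to all derivatives.  By
   induction on m, let F - sum_(k < m) h^k g_k be uniformly O(h^m) with all its derivatives.
   After division by h^m, subtracting g_m leaves a family that tends to 0 pointwise and has
   bounded derivatives, hence its first two derivatives tend to 0 as well; so the coefficient
   of h^m in the formal series L_h (sum h^k g_k) vanishes, and the two-point estimate gives the
   uniform O(h^(m+1)).

   That Bessel's equation holds for Y_n, n an integer, needs the limit in nu: 1/Gamma, hence
   J_nu(z), is differentiable in the order, so the quotient defining Y converges pointwise, and
   the two-point estimate shows that pointwise limits of solutions are solutions. *)

Require Import Defs.
From Stdlib Require Import Reals Lra Lia Factorial.
From Coquelicot Require Import Coquelicot.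
Open Scope R_scope.

(** * Derivatives, smooth functions, and the two-point estimate *)

(** The obstacle is that no recurrence for the [P_k] and [Q_k] is given, only pointwise expansions.
    Applied to the remainder after m terms, L_h leaves the coefficients of h^0, ..., h^(m-1) of the
    formal series, and no O(h^m) estimate is possible until these are known to vanish. They cannot
    be computed, so they are recovered from the function itself, and this has to be interleaved with
    the estimates: bounded derivatives at stage m are what allows a merely pointwise limit to be
    inserted into a differential operator.

    A single power series in h is enough because nu^(-1) t = h: after multiplication by t the
    Q-series is delayed by exactly one power of h, so [Q_(k-1)] joins [P_k]. An arbitrary pair of
    truncations is compared with this merged series at the end.

    The order derivative of J is reached through logarithms: for x > 0 the logarithm of Euler's
    product has a derivative that is elementary and uniformly Cauchy on bounded intervals, and
    1/Gamma(x) = x/Gamma(x + 1) carries the result to all real x. *)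

Lemma is_derive_val (f : R -> R) (x l l' : R) :
  is_derive f x l -> l = l' -> is_derive f x l'.
Proof. intros H <-; exact H. Qed.

Lemma is_derive_Rplus (f g : R -> R) (x df dg : R) :
  is_derive f x df -> is_derive g x dg -> is_derive (fun t => f t + g t) x (df + dg).
Proof. intros; now apply @is_derive_plus. Qed.

Lemma is_derive_Rmult (f g : R -> R) (x df dg : R) :
  is_derive f x df -> is_derive g x dg ->
  is_derive (fun t => f t * g t) x (df * g x + f x * dg).
Proof. intros; apply @is_derive_mult; auto; intros; apply Rmult_comm. Qed.

Lemma is_derive_Rcomp (f g : R -> R) (x df dg : R) :
  is_derive f (g x) df -> is_derive g x dg -> is_derive (fun t => f (g t)) x (df * dg).
Proof.
  intros Hf Hg. apply is_derive_val with (scal dg df).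
  now apply @is_derive_comp.
  apply Rmult_comm.
Qed.

Lemma is_derive_Rscal (f : R -> R) (c x df : R) :
  is_derive f x df -> is_derive (fun t => c * f t) x (c * df).
Proof. intros; now apply @is_derive_scal. Qed.

Lemma mean_value (f df : R -> R) (a b : R) :
  a < b -> (forall x, a <= x <= b -> is_derive f x (df x)) ->
  exists c, a <= c <= b /\ f b - f a = df c * (b - a).
Proof.
  intros Hab Hf.
  destruct (MVT_gen f a b df) as [c Hc].
  - rewrite Rmin_left, Rmax_right by lra. intros; apply Hf; lra.
  - rewrite Rmin_left, Rmax_right by lra. intros x Hx.
    apply continuity_pt_filterlim, @ex_derive_continuous. exists (df x); apply Hf; lra.
  - rewrite Rmin_left, Rmax_right in Hc by lra. now exists c.
Qed.

Lemma mean_value_bound (f df : R -> R) (a b M : R) :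
  (forall x, a <= x <= b -> is_derive f x (df x)) ->
  (forall x, a <= x <= b -> Rabs (df x) <= M) ->
  forall x y, a <= x <= b -> a <= y <= b -> Rabs (f y - f x) <= M * Rabs (y - x).
Proof.
  intros Hf HM.
  assert (H : forall x y, a <= x <= b -> a <= y <= b -> x < y ->
                Rabs (f y - f x) <= M * Rabs (y - x)).
  { intros x y Hx Hy Hxy.
    destruct (mean_value f df x y Hxy) as (c & Hc & ->).
    - intros; apply Hf; lra.
    - rewrite Rabs_mult. apply Rmult_le_compat_r; [apply Rabs_pos | apply HM; lra]. }
  intros x y Hx Hy.
  destruct (Rtotal_order x y) as [L | [-> | L]].
  - now apply H.
  - rewrite !Rminus_diag, Rabs_R0. lra.
  - rewrite (Rabs_minus_sym (f y)), (Rabs_minus_sym y). now apply H.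
Qed.

Lemma bounded_on_segment (f : R -> R) (a b : R) :
  (forall x, a <= x <= b -> ex_derive f x) ->
  exists M, 0 <= M /\ forall x, a <= x <= b -> Rabs (f x) <= M.
Proof.
  intros Hf.
  destruct (Rle_dec a b) as [Hab | Hab].
  - destruct (continuity_ab_maj (fun x => Rabs (f x)) a b Hab) as (m & Hm & Hm').
    + intros c Hc. apply (continuity_pt_comp f Rabs); [|apply Rcontinuity_abs].
      apply continuity_pt_filterlim, @ex_derive_continuous. now apply Hf.
    + exists (Rabs (f m)). split; [apply Rabs_pos | exact Hm].
  - exists 0. split; [lra | intros; lra].
Qed.

(** The successive derivatives are witnesses instead of [Derive_n], so that closure under sums,
    products and composition is a structural induction; [smooth_on_Derive_n] returns to [Derive_n]
    on an open set. *)
Fixpoint smooth_on (D : R -> Prop) (n : nat) (f : R -> R) : Prop :=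
  match n with
  | O => True
  | S m => exists f', (forall x, D x -> is_derive f x (f' x)) /\ smooth_on D m f'
  end.

Definition everywhere (x : R) : Prop := True.

Section SmoothOn.

Variable D : R -> Prop.

Lemma smooth_on_pred n f : smooth_on D (S n) f -> smooth_on D n f.
Proof.
  revert f; induction n as [|n IH]; intros f; [easy|].
  intros (f' & Hf & Hf'). exists f'. split; [exact Hf | now apply IH].
Qed.

Lemma smooth_on_const n c : smooth_on D n (fun _ => c).
Proof.
  revert c; induction n as [|n IH]; intros c; [easy|].
  exists (fun _ => 0). split; [|apply IH]. intros; apply @is_derive_const.
Qed.

Lemma smooth_on_id n : smooth_on D n (fun x => x).
Proof.
  destruct n as [|n]; [easy|].
  exists (fun _ => 1). split; [|apply smooth_on_const]. intros; apply @is_derive_id.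
Qed.

Lemma smooth_on_plus n f g :
  smooth_on D n f -> smooth_on D n g -> smooth_on D n (fun x => f x + g x).
Proof.
  revert f g; induction n as [|n IH]; intros f g; [easy|].
  intros (f' & Hf & Hf') (g' & Hg & Hg').
  exists (fun x => f' x + g' x). split; [|now apply IH].
  intros; apply is_derive_Rplus; auto.
Qed.

Lemma smooth_on_mult n f g :
  smooth_on D n f -> smooth_on D n g -> smooth_on D n (fun x => f x * g x).
Proof.
  revert f g; induction n as [|n IH]; intros f g; [easy|].
  intros Hf0 Hg0. pose proof (smooth_on_pred _ _ Hf0). pose proof (smooth_on_pred _ _ Hg0).
  destruct Hf0 as (f' & Hf & Hf'), Hg0 as (g' & Hg & Hg').
  exists (fun x => f' x * g x + f x * g' x). split.
  - intros; apply is_derive_Rmult; auto.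
  - apply smooth_on_plus; now apply IH.
Qed.

Lemma smooth_on_scal n c f : smooth_on D n f -> smooth_on D n (fun x => c * f x).
Proof. intros H. apply smooth_on_mult; [apply smooth_on_const | exact H]. Qed.

Lemma smooth_on_pow n k : smooth_on D n (fun x => x ^ k).
Proof.
  induction k as [|k IH]; simpl; [apply smooth_on_const|].
  apply smooth_on_mult; [apply smooth_on_id | exact IH].
Qed.

Lemma smooth_on_inv n : (forall x, D x -> x <> 0) -> smooth_on D n (fun x => / x).
Proof.
  intros HD. induction n as [|n IH]; [easy|].
  exists (fun x => -1 * (/ x * / x)). split.
  - intros x Hx. auto_derive; [now apply HD | field; now apply HD].
  - now apply smooth_on_scal, smooth_on_mult.
Qed.

Lemma smooth_on_sum n (f : nat -> R -> R) m :
  (forall k, smooth_on D n (f k)) -> smooth_on D n (fun x => sum_n (fun k => f k x) m).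
Proof.
  intros Hf. induction m as [|m IH].
  - destruct n as [|n]; [easy|]. destruct (Hf 0%nat) as (f' & H & H').
    exists f'. split; [|exact H']. intros x Hx.
    apply is_derive_ext with (f 0%nat); [|now apply H].
    intros; now rewrite sum_O.
  - pose proof (smooth_on_plus _ _ _ IH (Hf (S m))) as H.
    destruct n as [|n]; [easy|]. destruct H as (f' & H & H').
    exists f'. split; [|exact H']. intros x Hx.
    eapply is_derive_ext; [|now apply H].
    intros; now rewrite sum_Sn.
Qed.

Lemma smooth_on_ext n f g :
  open D -> (forall x, D x -> f x = g x) -> smooth_on D n f -> smooth_on D n g.
Proof.
  intros HD Hfg. destruct n as [|n]; [easy|]. intros (f' & H & H').
  exists f'. split; [|exact H']. intros x Hx.
  apply is_derive_ext_loc with f; [|now apply H].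
  apply (filter_imp D); [exact Hfg | now apply HD].
Qed.

Lemma smooth_on_Derive_n n f :
  open D -> smooth_on D n f -> forall k x, (k < n)%nat -> D x ->
  is_derive (Derive_n f k) x (Derive_n f (S k) x).
Proof.
  intros HD. revert f; induction n as [|n IH]; intros f; [lia|].
  intros (f' & Hf & Hf') k x Hk Hx.
  destruct k as [|k].
  - simpl. apply Derive_correct. exists (f' x). now apply Hf.
  - assert (E : forall j y, D y -> Derive_n f (S j) y = Derive_n f' j y).
    { intros j y Hy. rewrite <- (Nat.add_1_r j), <- Derive_n_comp.
      apply Derive_n_ext_loc. apply (filter_imp D); [|now apply HD].
      intros t Ht. apply is_derive_unique. now apply Hf. }
    rewrite (E (S k)) by exact Hx.
    apply is_derive_ext_loc with (Derive_n f' k).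
    + apply (filter_imp D); [|now apply HD]. intros; symmetry; now apply E.
    + apply IH; [exact Hf' | lia | exact Hx].
Qed.

End SmoothOn.

Lemma smooth_on_comp D E n f g :
  (forall x, D x -> E (g x)) -> smooth_on E n f -> smooth_on D n g ->
  smooth_on D n (fun x => f (g x)).
Proof.
  intros HDE. revert f; induction n as [|n IH]; intros f; [easy|].
  intros (f' & Hf & Hf') Hg. pose proof (smooth_on_pred _ _ _ Hg).
  destruct Hg as (g' & Hg & Hg').
  exists (fun x => f' (g x) * g' x). split.
  - intros; apply is_derive_Rcomp; auto.
  - apply smooth_on_mult; [now apply IH | exact Hg'].
Qed.

Lemma smooth_on_Derive n f :
  smooth_on everywhere (S n) f -> smooth_on everywhere n (Derive f).
Proof.
  intros (f' & Hf & Hf'). revert Hf'. apply smooth_on_ext; [apply open_true|].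
  intros x Hx. symmetry. apply is_derive_unique. now apply Hf.
Qed.

(** At some point [|e1| <= 2 rho / d], by the mean value theorem. Integrating [e2] from there bounds
    the maximum M of [|e1|] by [2 rho / d + d K (2 rho + (d + 1) M)]; since [d K <= 1/4] and
    [d <= 1], the part with M is at most M/2 and is absorbed. *)
Lemma two_point_estimate (e e1 e2 : R -> R) (c d K rho : R) :
  0 < d <= 1 -> 0 <= K -> d * K <= 1 / 4 ->
  (forall x, c <= x <= c + d -> is_derive e x (e1 x)) ->
  (forall x, c <= x <= c + d -> is_derive e1 x (e2 x)) ->
  (forall x, c <= x <= c + d -> Rabs (e2 x) <= K * (rho + Rabs (e x) + Rabs (e1 x))) ->
  Rabs (e c) <= rho -> Rabs (e (c + d)) <= rho ->
  forall x, c <= x <= c + d ->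
    Rabs (e x) <= (4 / d + 2) * rho /\ Rabs (e1 x) <= (4 / d + 2) * rho.
Proof.
  intros Hd HK HdK He He1 He2 Hc Hcd.
  assert (Hrho : 0 <= rho) by (eapply Rle_trans; [apply Rabs_pos | exact Hc]).
  destruct (continuity_ab_maj (fun x => Rabs (e1 x)) c (c + d)) as (m & Hm & Hm'); [lra| |].
  { intros x Hx. apply (continuity_pt_comp e1 Rabs); [|apply Rcontinuity_abs].
    apply continuity_pt_filterlim, @ex_derive_continuous. exists (e2 x). now apply He1. }
  set (M := Rabs (e1 m)) in *.
  assert (HM0 : 0 <= M) by apply Rabs_pos.
  destruct (mean_value e e1 c (c + d)) as (xi & Hxi & Exi); [lra | exact He |].
  replace (c + d - c) with d in Exi by ring.
  assert (Hxi1 : Rabs (e1 xi) * d <= 2 * rho).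
  { rewrite <- (Rabs_pos_eq d) at 1 by lra. rewrite <- Rabs_mult, <- Exi.
    pose proof (Rabs_triang (e (c + d)) (- e c)) as T. rewrite Rabs_Ropp in T.
    unfold Rminus. lra. }
  assert (Hex : forall x, c <= x <= c + d -> Rabs (e x) <= rho + d * M).
  { intros x Hx.
    pose proof (mean_value_bound e e1 c (c + d) M He Hm c x) as T.
    assert (c <= c <= c + d) by lra. specialize (T H Hx).
    pose proof (Rabs_triang (e x - e c) (e c)) as T'.
    replace (e x - e c + e c) with (e x) in T' by ring.
    rewrite (Rabs_pos_eq (x - c)) in T by lra.
    assert (M * (x - c) <= M * d) by (apply Rmult_le_compat_l; lra). lra. }
  assert (H2 : forall x, c <= x <= c + d -> Rabs (e2 x) <= K * (2 * rho + (d + 1) * M)).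
  { intros x Hx. eapply Rle_trans; [now apply He2|].
    apply Rmult_le_compat_l; [exact HK|].
    specialize (Hex x Hx). specialize (Hm x Hx). lra. }
  assert (Hxm : M <= Rabs (e1 xi) + K * (2 * rho + (d + 1) * M) * d).
  { pose proof (mean_value_bound e1 e2 c (c + d) _ He1 H2 xi m Hxi Hm') as T.
    pose proof (Rabs_triang (e1 m - e1 xi) (e1 xi)) as T'.
    replace (e1 m - e1 xi + e1 xi) with (e1 m) in T' by ring. fold M in T'.
    assert (Rabs (m - xi) <= d) by (apply Rabs_le; lra).
    assert (0 <= K * (2 * rho + (d + 1) * M)).
    { apply Rmult_le_pos; [exact HK|]. nra. }
    assert (K * (2 * rho + (d + 1) * M) * Rabs (m - xi)
            <= K * (2 * rho + (d + 1) * M) * d) by (apply Rmult_le_compat_l; lra).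
    lra. }
  assert (HM : M <= (4 / d + 1) * rho).
  { assert (A : Rabs (e1 xi) <= 2 / d * rho).
    { apply Rmult_le_reg_r with d; [lra|]. replace (2 / d * rho * d) with (2 * rho) by (field; lra).
      exact Hxi1. }
    assert (B : d * K * (2 * rho + (d + 1) * M) <= 1 / 4 * (2 * rho + 2 * M)).
    { apply Rmult_le_compat; try nra. }
    replace (K * (2 * rho + (d + 1) * M) * d) with (d * K * (2 * rho + (d + 1) * M)) in Hxm by ring.
    replace (4 / d) with (2 * (2 / d)) by (field; lra). nra. }
  intros x Hx. split.
  - eapply Rle_trans; [now apply Hex|].
    assert (d * M <= 1 * M) by (apply Rmult_le_compat_r; lra). lra.
  - eapply Rle_trans; [now apply Hm|]. lra.
Qed.

(** * Limits of functions with uniformly Cauchy derivatives *)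

Definition unif_cauchy (D : R -> Prop) (f : nat -> R -> R) : Prop :=
  forall eps : posreal, exists N : nat, forall n m x, (N <= n)%nat -> (N <= m)%nat -> D x ->
    Rabs (f n x - f m x) <= eps.

Lemma cauchy_lim (u : nat -> R) :
  (forall eps : posreal, exists N : nat, forall n m, (N <= n)%nat -> (N <= m)%nat ->
     Rabs (u n - u m) <= eps) ->
  is_lim_seq u (real (Lim_seq u)).
Proof.
  intros H. apply Lim_seq_correct', ex_lim_seq_cauchy_corr.
  intros eps. destruct (H (pos_div_2 eps)) as [N HN]. exists N. intros n m Hn Hm.
  eapply Rle_lt_trans; [now apply HN|]. pose proof (cond_pos eps). simpl. lra.
Qed.

Lemma is_lim_seq_Rabs_le (u : nat -> R) (l M : R) :
  eventually (fun n => Rabs (u n) <= M) -> is_lim_seq u l -> Rabs l <= M.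
Proof.
  intros H Hu.
  apply (is_lim_seq_le_loc (fun n => Rabs (u n)) (fun _ => M) (Rabs l) M).
  - exact H.
  - now apply (is_lim_seq_abs u l).
  - apply is_lim_seq_const.
Qed.

Section DeriveLim.

Variables (a b : R) (f g : nat -> R -> R).
Hypothesis Hfg : forall n x, a < x < b -> is_derive (f n) x (g n x).
Hypothesis Hg : unif_cauchy (fun x => a < x < b) g.

(** The mean value theorem for [f n - f m], whose derivative is uniformly small. Existence and
    differentiability of the limit both rest on this Lipschitz bound. *)
Lemma lim_increments (eps : posreal) :
  exists N, forall n m x y, (N <= n)%nat -> (N <= m)%nat -> a < x < b -> a < y < b ->
    Rabs ((f n y - f m y) - (f n x - f m x)) <= eps * Rabs (y - x).
Proof.
  destruct (Hg eps) as [N HN]. exists N. intros n m x y Hn Hm Hx Hy.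
  pose proof (Rmin_l x y). pose proof (Rmin_r x y).
  pose proof (Rmax_l x y). pose proof (Rmax_r x y).
  assert (a < Rmin x y) by (apply Rmin_glb_lt; lra).
  assert (Rmax x y < b) by (apply Rmax_lub_lt; lra).
  apply (mean_value_bound (fun t => f n t - f m t) (fun t => g n t - g m t)
           (Rmin x y) (Rmax x y)); try lra.
  - intros t Ht. apply @is_derive_minus; apply Hfg; lra.
  - intros t Ht. apply HN; auto; lra.
Qed.

Lemma ex_lim_of_derive (c : R) :
  a < c < b -> ex_finite_lim_seq (fun n => f n c) ->
  forall x, a < x < b -> is_lim_seq (fun n => f n x) (real (Lim_seq (fun n => f n x))).
Proof.
  intros Hc Hlim x Hx. apply cauchy_lim. intros eps.
  assert (Hp : 0 < eps / 2 / (Rabs (x - c) + 1)).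
  { apply Rdiv_lt_0_compat; [apply is_pos_div_2 | pose proof (Rabs_pos (x - c)); lra]. }
  destruct (lim_increments (mkposreal _ Hp)) as [N1 HN1].
  apply ex_lim_seq_cauchy_corr in Hlim. destruct (Hlim (pos_div_2 eps)) as [N2 HN2].
  exists (N1 + N2)%nat. intros n m Hn Hm.
  specialize (HN1 n m c x ltac:(lia) ltac:(lia) Hc Hx).
  specialize (HN2 n m ltac:(lia) ltac:(lia)). simpl in *.
  assert (eps / 2 / (Rabs (x - c) + 1) * Rabs (x - c) <= eps / 2).
  { pose proof (cond_pos eps). pose proof (Rabs_pos (x - c)).
    rewrite <- (Rmult_1_r (eps / 2)) at 2. unfold Rdiv at 1. rewrite Rmult_assoc.
    apply Rmult_le_compat_l; [lra|].
    apply Rmult_le_reg_l with (Rabs (x - c) + 1); [lra|].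
    rewrite <- Rmult_assoc, Rinv_r by lra. lra. }
  pose proof (Rabs_triang (f n x - f m x - (f n c - f m c)) (f n c - f m c)) as T.
  replace (f n x - f m x - (f n c - f m c) + (f n c - f m c)) with (f n x - f m x) in T by ring.
  lra.
Qed.

Lemma lim_derive_correct x :
  a < x < b -> is_lim_seq (fun n => g n x) (real (Lim_seq (fun n => g n x))).
Proof.
  intros Hx. apply cauchy_lim. intros eps. destruct (Hg eps) as [N HN].
  exists N. intros; now apply HN.
Qed.

Lemma is_derive_lim (F : R -> R) :
  (forall x, a < x < b -> is_lim_seq (fun n => f n x) (F x)) ->
  forall x, a < x < b -> is_derive F x (real (Lim_seq (fun n => g n x))).
Proof.
  intros HF x Hx. set (l := real _).
  assert (Hl : is_lim_seq (fun n => g n x) l) by now apply lim_derive_correct.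
  apply is_derive_Reals. intros eps Heps.
  assert (Heps4 : 0 < eps / 4) by lra. set (e4 := mkposreal _ Heps4).
  destruct (lim_increments e4) as [N1 HN1].
  apply is_lim_seq_spec in Hl. destruct (Hl e4) as [N2 HN2].
  set (n := (N1 + N2)%nat).
  specialize (HN2 n ltac:(lia)). simpl in HN2.
  pose proof (Hfg n x Hx) as Hd. apply is_derive_Reals in Hd.
  destruct (Hd (eps / 4) Heps4) as [del Hdel].
  assert (Hp : 0 < Rmin del (Rmin (x - a) (b - x))).
  { apply Rmin_pos; [apply cond_pos | apply Rmin_pos; lra]. }
  exists (mkposreal _ Hp). intros h Hh Hhd. simpl in Hhd.
  pose proof (Rmin_l del (Rmin (x - a) (b - x))).
  pose proof (Rmin_r del (Rmin (x - a) (b - x))).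
  pose proof (Rmin_l (x - a) (b - x)). pose proof (Rmin_r (x - a) (b - x)).
  assert (Hxh : a < x + h < b) by (apply Rabs_def2 in Hhd; lra).
  specialize (Hdel h Hh ltac:(lra)).
  (* Letting m tend to infinity in [lim_increments] transfers the bound to [f n - F]. *)
  assert (Hq : Rabs ((f n (x + h) - F (x + h)) - (f n x - F x)) <= eps / 4 * Rabs h).
  { apply is_lim_seq_Rabs_le with (fun m => (f n (x + h) - f m (x + h)) - (f n x - f m x)).
    - exists N1. intros m Hm. replace h with (x + h - x) at 3 by ring.
      apply HN1; auto; lia.
    - apply is_lim_seq_minus'; apply is_lim_seq_minus'; try apply is_lim_seq_const; now apply HF. }
  assert (Hq' : Rabs ((F (x + h) - F x) / h - (f n (x + h) - f n x) / h) <= eps / 4).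
  { replace ((F (x + h) - F x) / h - (f n (x + h) - f n x) / h)
      with (- ((f n (x + h) - F (x + h)) - (f n x - F x)) / h) by (field; exact Hh).
    unfold Rdiv at 1. rewrite Rabs_mult, Rabs_inv, Rabs_Ropp.
    apply Rmult_le_reg_r with (Rabs h); [now apply Rabs_pos_lt|].
    rewrite Rmult_assoc, Rinv_l, Rmult_1_r; [exact Hq | now apply Rabs_no_R0]. }
  replace ((F (x + h) - F x) / h - l) with
    (((F (x + h) - F x) / h - (f n (x + h) - f n x) / h)
     + (((f n (x + h) - f n x) / h - g n x) + (g n x - l))) by ring.
  pose proof (Rabs_triang ((F (x + h) - F x) / h - (f n (x + h) - f n x) / h)
     (((f n (x + h) - f n x) / h - g n x) + (g n x - l))).
  pose proof (Rabs_triang ((f n (x + h) - f n x) / h - g n x) (g n x - l)).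
  lra.
Qed.

End DeriveLim.

(** * Formal expansions of solutions in the transition region *)

(** The lower derivatives come from Leibniz' rule. Where [pred] truncates, at l = 0 or, for
    [pred (pred l)], at l = 0 and 1, the factor [INR l] or [INR l * (INR l - 1)] is zero. *)
Definition op0 (u : nat -> R -> R) (l : nat) (a : R) : R :=
  u (S (S l)) a + 2 * a * u l a + 2 * INR l * u (pred l) a.

Definition op1 (u : nat -> R -> R) (l : nat) (a : R) : R :=
  2 * a * u (S (S l)) a + (2 * INR l + 1) * u (S l) a + a ^ 2 * u l a
  + 2 * INR l * a * u (pred l) a + INR l * (INR l - 1) * u (pred (pred l)) a.

Definition op2 (u : nat -> R -> R) (l : nat) (a : R) : R :=
  a ^ 2 * u (S (S l)) a + (2 * INR l + 1) * a * u (S l) a + INR l ^ 2 * u l a.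

(* With [u j] the [j]-th derivative of [u], this is the [l]-th derivative of
   [(1 + a h)^2 u'' + h (1 + a h) u' + (2 a + a^2 h) u], sorted by powers of [h];
   Bessel's equation in the transition region says that it vanishes. *)
Definition bessel_op (h : R) (u : nat -> R -> R) (l : nat) (a : R) : R :=
  op0 u l a + h * op1 u l a + h ^ 2 * op2 u l a.

Lemma bessel_op_eq h u l a :
  bessel_op h u l a =
  (1 + a * h) ^ 2 * u (S (S l)) a + (2 * INR l + 1) * h * (1 + a * h) * u (S l) a
  + (INR l ^ 2 * h ^ 2 + 2 * a + a ^ 2 * h) * u l a
  + 2 * INR l * (1 + a * h) * u (pred l) a
  + INR l * (INR l - 1) * h * u (pred (pred l)) a.
Proof. unfold bessel_op, op0, op1, op2. ring. Qed.

(** A function is carried along with all its derivatives as data, so the operators act on them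
    algebraically. The property is stated at a point because it will hold only on an interval and
    only far along the filter. *)
Definition tower (u : nat -> R -> R) (a : R) : Prop :=
  forall j, is_derive (u j) a (u (S j) a).

Lemma tower_Derive u a j : tower u a -> Derive (u j) a = u (S j) a.
Proof. intros H. apply is_derive_unique, H. Qed.

Ltac derive_tower H :=
  auto_derive;
  [ repeat split; eexists; apply H
  | repeat change (fun x => ?f x) with f; rewrite ?(fun j => tower_Derive _ _ j H) ].

Lemma op0_tower u a : tower u a -> tower (op0 u) a.
Proof.
  intros H l. unfold op0. derive_tower H.
  rewrite S_INR. destruct l; simpl pred; [simpl INR|]; ring.
Qed.

Lemma op1_tower u a : tower u a -> tower (op1 u) a.
Proof.
  intros H l. unfold op1. derive_tower H.
  rewrite S_INR. destruct l as [|[|l]]; simpl pred; rewrite ?S_INR; simpl INR; ring.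
Qed.

Lemma op2_tower u a : tower u a -> tower (op2 u) a.
Proof.
  intros H l. unfold op2. derive_tower H.
  rewrite S_INR. ring.
Qed.

Lemma tower_plus u v a : tower u a -> tower v a -> tower (fun j x => u j x + v j x) a.
Proof. intros Hu Hv j. now apply is_derive_Rplus. Qed.

Lemma tower_scal c u a : tower u a -> tower (fun j x => c * u j x) a.
Proof. intros Hu j. now apply is_derive_Rscal. Qed.

Lemma bessel_op_tower h u a : tower u a -> tower (bessel_op h u) a.
Proof.
  intros H. unfold bessel_op.
  apply (tower_plus (fun l x => op0 u l x + h * op1 u l x) (fun l x => h ^ 2 * op2 u l x)).
  - apply (tower_plus (op0 u) (fun l x => h * op1 u l x)).
    + now apply op0_tower.
    + now apply (tower_scal h (op1 u)), op1_tower.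
  - now apply (tower_scal (h ^ 2) (op2 u)), op2_tower.
Qed.

(** This is how an identity for l = 0, such as Bessel's equation or a vanishing residual, is
    differentiated any number of times. *)
Lemma tower_zero u a b :
  (forall x, a < x < b -> tower u x) -> (forall x, a < x < b -> u 0%nat x = 0) ->
  forall l x, a < x < b -> u l x = 0.
Proof.
  intros Hu H0. induction l as [|l IH]; intros x Hx; [now apply H0|].
  rewrite <- (is_derive_unique _ _ _ (Hu x Hx l)).
  rewrite <- (Derive_const 0 x). apply Derive_ext_loc.
  assert (Hp : 0 < Rmin (x - a) (b - x)) by (apply Rmin_pos; lra).
  exists (mkposreal _ Hp). intros y Hy. apply IH.
  pose proof (Rmin_l (x - a) (b - x)). pose proof (Rmin_r (x - a) (b - x)).
  apply Rabs_def2 in Hy. unfold minus, plus, opp in Hy. simpl in Hy. lra.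
Qed.

(** * Expansions in a small parameter along an arbitrary filter *)

Section Expansion.

Context {T : Type} (Fl : (T -> Prop) -> Prop) {FF : ProperFilter Fl}.
Variables (h : T -> R) (F : T -> nat -> R -> R) (g : nat -> nat -> R -> R).

Hypothesis h_pos : Fl (fun t => 0 < h t).
Hypothesis h_small : forall eps, 0 < eps -> Fl (fun t => h t < eps).
Hypothesis F_tower : forall A B, Fl (fun t => forall a, A <= a <= B -> tower (F t) a).
Hypothesis F_eq :
  forall A B, Fl (fun t => forall a, A <= a <= B -> bessel_op (h t) (F t) 0 a = 0).
Hypothesis g_tower : forall k a, tower (g k) a.

(** The quantifier over [a] stands inside the filter, which makes the bound uniform on the segment;
    [A = B] gives the pointwise version. *)
Definition big_O (m : nat) (A B : R) (f : T -> R -> R) : Prop :=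
  exists C, Fl (fun t => forall a, A <= a <= B -> Rabs (f t a) <= C * h t ^ m).

Lemma big_O_pos m A B f :
  big_O m A B f ->
  exists C, 0 < C /\ Fl (fun t => forall a, A <= a <= B -> Rabs (f t a) <= C * h t ^ m).
Proof.
  intros [C HC]. exists (Rabs C + 1). split; [pose proof (Rabs_pos C); lra|].
  generalize (filter_and _ _ h_pos HC). apply filter_imp. intros t [Ht H] a Ha.
  eapply Rle_trans; [now apply H|]. apply Rmult_le_compat_r.
  - apply pow_le; lra.
  - pose proof (Rle_abs C). lra.
Qed.

Lemma big_O_plus m A B f1 f2 :
  big_O m A B f1 -> big_O m A B f2 -> big_O m A B (fun t a => f1 t a + f2 t a).
Proof.
  intros [C1 H1] [C2 H2]. exists (C1 + C2).
  generalize (filter_and _ _ H1 H2). apply filter_imp. intros t [K1 K2] a Ha.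
  eapply Rle_trans; [apply Rabs_triang|]. specialize (K1 a Ha). specialize (K2 a Ha). lra.
Qed.

Lemma big_O_ext m A B f1 f2 :
  Fl (fun t => forall a, A <= a <= B -> f1 t a = f2 t a) ->
  big_O m A B f1 -> big_O m A B f2.
Proof.
  intros E [C H]. exists C. generalize (filter_and _ _ E H). apply filter_imp.
  intros t [E' H'] a Ha. rewrite <- E' by exact Ha. now apply H'.
Qed.

Lemma big_O_power_mult m k A B (f : R -> R) :
  (m <= k)%nat -> (forall a, ex_derive f a) -> big_O m A B (fun t a => h t ^ k * f a).
Proof.
  intros Hmk Hf. destruct (bounded_on_segment f A B) as (M & HM0 & HM); [auto|].
  exists M. generalize (filter_and _ _ h_pos (h_small 1 Rlt_0_1)). apply filter_imp.
  intros t [Ht Ht'] a Ha. specialize (HM a Ha).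
  assert (Hp : 0 <= h t ^ k) by (apply pow_le; lra).
  rewrite Rabs_mult, (Rabs_pos_eq (h t ^ k)), Rmult_comm by exact Hp.
  apply Rmult_le_compat; auto using Rabs_pos.
  replace k with (m + (k - m))%nat by lia. rewrite pow_add.
  rewrite <- (Rmult_1_r (h t ^ m)) at 2. apply Rmult_le_compat_l; [apply pow_le; lra|].
  rewrite <- (pow1 (k - m)). apply pow_incr. lra.
Qed.

Section APriori.

Variables (m : nat) (e : T -> nat -> R -> R).
Hypothesis e_tower : forall A B, Fl (fun t => forall a, A <= a <= B -> tower (e t) a).
Hypothesis e_op : forall A B l, big_O m A B (fun t => bessel_op (h t) (e t) l).
Hypothesis e_pointwise : forall a, big_O m a a (fun t => e t 0%nat).

(** For [|a| <= X] this keeps [1 + a h] in [1/2, 3/2], so the leading coefficient [(1 + a h)^2] of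
    the equation can be divided out at the cost of a factor 4. *)
Lemma h_le_inv (X : R) : 0 < X -> Fl (fun t => 0 < h t <= 1 /\ X * h t <= 1 / 2).
Proof.
  intros HX. assert (Hd : 0 < / (2 * X)) by (apply Rinv_0_lt_compat; lra).
  generalize (filter_and _ _ h_pos
    (filter_and _ _ (h_small 1 Rlt_0_1) (h_small _ Hd))).
  apply filter_imp. intros t (H1 & H2 & H3). repeat split; try lra.
  apply Rmult_le_reg_l with (/ X); [now apply Rinv_0_lt_compat|].
  rewrite <- Rmult_assoc, Rinv_l, Rmult_1_l by lra.
  replace (/ X * (1 / 2)) with (/ (2 * X)) by (field; lra). lra.
Qed.

Lemma one_plus_bounds (X hh a : R) :
  Rabs a <= X -> 0 < hh -> X * hh <= 1 / 2 -> 1 / 2 <= 1 + a * hh <= 3 / 2.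
Proof.
  intros Ha Hh HX. apply Rabs_le_between in Ha.
  assert (a * hh <= X * hh) by (apply Rmult_le_compat_r; lra).
  assert (- X * hh <= a * hh) by (apply Rmult_le_compat_r; lra). lra.
Qed.

Lemma Rabs_solve (c x y : R) : 1 / 2 <= c -> c ^ 2 * x = y -> Rabs x <= 4 * Rabs y.
Proof.
  intros Hc <-. rewrite Rabs_mult, (Rabs_pos_eq (c ^ 2)) by nra.
  pose proof (Rabs_pos x). assert (1 / 4 <= c ^ 2) by nra. nra.
Qed.

Lemma Rabs_sum5_le (x1 x2 x3 x4 x5 b1 b2 b3 b4 b5 : R) :
  Rabs x1 <= b1 -> Rabs x2 <= b2 -> Rabs x3 <= b3 -> Rabs x4 <= b4 -> Rabs x5 <= b5 ->
  Rabs (x1 - x2 - x3 - x4 - x5) <= b1 + b2 + b3 + b4 + b5.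
Proof.
  intros H1 H2 H3 H4 H5.
  apply Rabs_le_between in H1, H2, H3, H4, H5. apply Rabs_le. lra.
Qed.

Lemma Rabs_mult_le (x y bx bY : R) :
  Rabs x <= bx -> Rabs y <= bY -> Rabs (x * y) <= bx * bY.
Proof. intros. rewrite Rabs_mult. apply Rmult_le_compat; auto using Rabs_pos. Qed.

(** Solve the equation for the second derivative; its right-hand side contributes the term [h^m].
    What matters is that K is independent of t, since K determines the mesh of the grid in
    [a_priori_low]. *)
Lemma second_derivative_bound A B :
  exists K, 0 < K /\ Fl (fun t => forall a, A <= a <= B ->
    Rabs (e t 2%nat a) <= K * (h t ^ m + Rabs (e t 0%nat a) + Rabs (e t 1%nat a))).
Proof.
  destruct (big_O_pos _ _ _ _ (e_op A B 0)) as (C & HC & H).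
  set (X := Rabs A + Rabs B + 1).
  assert (HX : 0 < X) by (pose proof (Rabs_pos A); pose proof (Rabs_pos B); unfold X; lra).
  exists (4 * (C + 2 + 2 * X + X ^ 2)). split; [nra|].
  generalize (filter_and _ _ H (h_le_inv X HX)). apply filter_imp.
  intros t (Hop & Hh & HhX) a Ha.
  assert (HaX : Rabs a <= X).
  { unfold X. apply Rabs_le. pose proof (Rle_abs A). pose proof (Rle_abs B).
    pose proof (Rle_abs (- A)). pose proof (Rle_abs (- B)). rewrite Rabs_Ropp in *. lra. }
  pose proof (one_plus_bounds X (h t) a HaX ltac:(lra) HhX) as H1.
  specialize (Hop a Ha). set (r := bessel_op (h t) (e t) 0 a) in *.
  eapply Rle_trans.
  { apply (Rabs_solve (1 + a * h t) (e t 2%nat a)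
      (r - h t * (1 + a * h t) * e t 1%nat a - (2 * a + a ^ 2 * h t) * e t 0%nat a - 0 - 0));
      [lra|].
    unfold r. rewrite bessel_op_eq. simpl. ring. }
  assert (Hp : 0 <= h t ^ m) by (apply pow_le; lra).
  pose proof (Rabs_pos (e t 0%nat a)). pose proof (Rabs_pos (e t 1%nat a)).
  assert (B1 : Rabs (h t * (1 + a * h t)) <= 2) by (apply Rabs_le; nra).
  assert (B2 : Rabs (2 * a + a ^ 2 * h t) <= 2 * X + X ^ 2).
  { eapply Rle_trans; [apply Rabs_triang|].
    apply Rplus_le_compat.
    - rewrite Rabs_mult, (Rabs_pos_eq 2) by lra. lra.
    - rewrite <- (Rmult_1_r (X ^ 2)). apply Rabs_mult_le.
      + rewrite <- RPow_abs. apply pow_incr. split; [apply Rabs_pos | exact HaX].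
      + rewrite Rabs_pos_eq; lra. }
  pose proof (Rabs_sum5_le _ _ _ _ _ _ _ _ _ _ Hop
    (Rabs_mult_le _ _ _ _ B1 (Rle_refl (Rabs (e t 1%nat a))))
    (Rabs_mult_le _ _ _ _ B2 (Rle_refl (Rabs (e t 0%nat a))))
    (Req_le _ _ Rabs_R0) (Req_le _ _ Rabs_R0)) as S5.
  replace (4 * (C + 2 + 2 * X + X ^ 2) * (h t ^ m + Rabs (e t 0%nat a) + Rabs (e t 1%nat a)))
    with (4 * ((C + 2 + 2 * X + X ^ 2) * (h t ^ m + Rabs (e t 0%nat a) + Rabs (e t 1%nat a))))
    by ring.
  apply Rmult_le_compat_l; [lra|]. eapply Rle_trans; [exact S5|].
  assert (0 <= X ^ 2) by nra.
  assert (0 <= (2 + 2 * X + X ^ 2) * h t ^ m) by (apply Rmult_le_pos; lra).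
  assert (0 <= (C + 2) * Rabs (e t 0%nat a)) by (apply Rmult_le_pos; lra).
  assert (0 <= (C + 2 * X + X ^ 2) * Rabs (e t 1%nat a)) by (apply Rmult_le_pos; lra).
  lra.
Qed.

(** With more than [L (4 K + 1)] steps, [d <= 1 / (4 K + 1)], and this yields both [d <= 1] and
    [d K <= 1/4]. *)
Lemma short_step (L K : R) :
  0 < L -> 0 < K -> exists (n : nat) (d : R), 0 < d <= 1 /\ d * K <= 1 / 4 /\ INR n * d = L.
Proof.
  intros HL HK. destruct (nfloor_ex (L * (4 * K + 1)) ltac:(nra)) as (n & Hn1 & Hn2).
  exists (S n), (L / INR (S n)). rewrite S_INR. pose proof (pos_INR n).
  assert (E : L / (INR n + 1) <= / (4 * K + 1)).
  { apply Rmult_le_reg_r with ((INR n + 1) * (4 * K + 1)); [nra|].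
    replace (L / (INR n + 1) * ((INR n + 1) * (4 * K + 1))) with (L * (4 * K + 1))
      by (field; lra).
    replace (/ (4 * K + 1) * ((INR n + 1) * (4 * K + 1))) with (INR n + 1) by (field; lra).
    lra. }
  repeat split.
  - apply Rdiv_lt_0_compat; lra.
  - eapply Rle_trans; [exact E|]. rewrite <- Rinv_1. apply Rinv_le_contravar; lra.
  - apply Rle_trans with (/ (4 * K + 1) * K).
    + apply Rmult_le_compat_r; lra.
    + apply Rmult_le_reg_r with (4 * K + 1); [lra|].
      replace (/ (4 * K + 1) * K * (4 * K + 1)) with K by (field; lra). lra.
  - field. lra.
Qed.

Lemma a_priori_low A B : big_O m A B (fun t => e t 0%nat) /\ big_O m A B (fun t => e t 1%nat).
Proof.
  (* The enlarged endpoint makes the segment nondegenerate even if [B < A], and places B strictly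
     inside the half-open range covered by the grid. *)
  set (B' := Rmax A B + 1).
  assert (HAB : A < B') by (pose proof (Rmax_l A B); unfold B'; lra).
  destruct (second_derivative_bound A B') as (K & HK & H2).
  destruct (short_step (B' - A) K ltac:(lra) HK) as (n & d & Hd & HdK & Hn).
  (* One cell is added at a time. The grid is the same for all t, so only finitely many pointwise
     bounds are intersected in the filter, and the constant is a maximum over finitely many cells.
     For i = 0 the range is empty. *)
  assert (Hgrid : forall i, (i <= n)%nat -> exists C, Fl (fun t => forall a,
    A <= a -> a < A + INR i * d ->
    Rabs (e t 0%nat a) <= C * h t ^ m /\ Rabs (e t 1%nat a) <= C * h t ^ m)).
  { induction i as [|i IH]; intros Hi.
    - exists 0. apply filter_forall. simpl. intros; lra.
    - destruct (IH ltac:(lia)) as [C HC].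
      set (c := A + INR i * d).
      destruct (big_O_pos _ _ _ _ (e_pointwise c)) as (C1 & HC1 & HP1).
      destruct (big_O_pos _ _ _ _ (e_pointwise (c + d))) as (C2 & HC2 & HP2).
      set (rho := fun t => (C1 + C2 + 1) * h t ^ m).
      set (C3 := (4 / d + 2) * (C1 + C2 + 1)).
      exists (Rmax C C3).
      generalize (filter_and _ _ h_pos (filter_and _ _ HC (filter_and _ _ HP1
        (filter_and _ _ HP2 (filter_and _ _ H2 (e_tower A B')))))).
      apply filter_imp. intros t (Hh & K0 & K1 & K2 & K3 & K4).
      assert (Hp : 0 <= h t ^ m) by (apply pow_le; lra).
      assert (HM1 : C * h t ^ m <= Rmax C C3 * h t ^ m)
        by (apply Rmult_le_compat_r; [exact Hp | apply Rmax_l]).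
      assert (HM2 : C3 * h t ^ m <= Rmax C C3 * h t ^ m)
        by (apply Rmult_le_compat_r; [exact Hp | apply Rmax_r]).
      intros a HaA Ha. rewrite S_INR in Ha.
      destruct (Rlt_le_dec a c) as [L | L].
      + destruct (K0 a HaA L). lra.
      + assert (HcA : A <= c).
        { unfold c. pose proof (pos_INR i). nra. }
        assert (HcB : c + d <= B').
        { apply le_INR in Hi. rewrite S_INR in Hi. unfold c. nra. }
        assert (HC0 : (C1 + C2 + 1) * h t ^ m = C1 * h t ^ m + C2 * h t ^ m + h t ^ m) by ring.
        assert (0 <= C1 * h t ^ m) by (apply Rmult_le_pos; lra).
        assert (0 <= C2 * h t ^ m) by (apply Rmult_le_pos; lra).
        destruct (two_point_estimate (e t 0%nat) (e t 1%nat) (e t 2%nat) c d K (rho t) Hd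
          ltac:(lra) HdK) with (x := a) as [E0 E1].
        * intros x Hx. apply K4. lra.
        * intros x Hx. apply K4. lra.
        * intros x Hx. eapply Rle_trans; [apply K3; lra|].
          apply Rmult_le_compat_l; [lra|]. unfold rho. lra.
        * unfold rho. specialize (K1 c ltac:(lra)). lra.
        * unfold rho. specialize (K2 (c + d) ltac:(lra)). lra.
        * unfold c in *. lra.
        * unfold rho in E0, E1. rewrite <- Rmult_assoc in E0, E1. fold C3 in E0, E1. lra. }
  destruct (Hgrid n (le_n n)) as [C HC].
  assert (HB : B < A + INR n * d) by (pose proof (Rmax_r A B); rewrite Hn; unfold B'; lra).
  split; exists C; revert HC; apply filter_imp; intros t H a Ha; apply H; lra.
Qed.

(** The equation differentiated n times expresses derivative n + 2 by lower ones with bounded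
    coefficients, so the bounds on the function and its first derivative propagate upwards. *)
Lemma a_priori A B l : big_O m A B (fun t => e t l).
Proof.
  enough (H : forall n l, (l <= S n)%nat -> big_O m A B (fun t => e t l))
    by (apply (H l); lia).
  clear l. induction n as [|n IH]; intros l Hl.
  - destruct (a_priori_low A B). destruct l as [|[|l]]; [easy | easy | lia].
  - destruct (Nat.eq_dec l (S (S n))) as [-> | Hne]; [|apply IH; lia].
    clear Hl.
    destruct (big_O_pos _ _ _ _ (e_op A B n)) as (C & HC & H).
    destruct (big_O_pos _ _ _ _ (IH (S n) ltac:(lia))) as (C1 & HC1 & H1).
    destruct (big_O_pos _ _ _ _ (IH n ltac:(lia))) as (C2 & HC2 & H2).
    destruct (big_O_pos _ _ _ _ (IH (pred n) ltac:(lia))) as (C3 & HC3 & H3).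
    destruct (big_O_pos _ _ _ _ (IH (pred (pred n)) ltac:(lia))) as (C4 & HC4 & H4).
    set (X := Rabs A + Rabs B + 1).
    assert (HX : 0 < X) by (pose proof (Rabs_pos A); pose proof (Rabs_pos B); unfold X; lra).
    set (N := INR n).
    (* Each product bounds one term of [bessel_op_eq], using [1 + a h <= 2] and [h <= 1]; [N + 1]
       bounds [|N - 1|] also at N = 0. *)
    exists (4 * (C + (2 * N + 1) * 2 * C1 + (N ^ 2 + 2 * X + X ^ 2) * C2 + 2 * N * 2 * C3
                 + N * (N + 1) * C4)).
    generalize (filter_and _ _ H (filter_and _ _ H1 (filter_and _ _ H2 (filter_and _ _ H3
      (filter_and _ _ H4 (h_le_inv X HX)))))).
    apply filter_imp.
    intros t (Hop & K1 & K2 & K3 & K4 & Hh & HhX) a Ha.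
    assert (HaX : Rabs a <= X).
    { unfold X. apply Rabs_le. pose proof (Rle_abs A). pose proof (Rle_abs B).
      pose proof (Rle_abs (- A)). pose proof (Rle_abs (- B)). rewrite Rabs_Ropp in *. lra. }
    pose proof (one_plus_bounds X (h t) a HaX ltac:(lra) HhX) as Hb.
    assert (HN : 0 <= N) by apply pos_INR.
    specialize (Hop a Ha). set (r := bessel_op (h t) (e t) n a) in *.
    eapply Rle_trans.
    { apply (Rabs_solve (1 + a * h t) (e t (S (S n)) a)
        (r - (2 * N + 1) * (h t * (1 + a * h t)) * e t (S n) a
         - (N ^ 2 * h t ^ 2 + 2 * a + a ^ 2 * h t) * e t n a
         - 2 * N * (1 + a * h t) * e t (pred n) a
         - N * ((N - 1) * h t) * e t (pred (pred n)) a)); [lra|].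
      unfold r. rewrite bessel_op_eq. fold N. ring. }
    rewrite (Rmult_assoc 4). apply Rmult_le_compat_l; [lra|].
    assert (B1 : Rabs ((2 * N + 1) * (h t * (1 + a * h t))) <= (2 * N + 1) * 2).
    { apply Rabs_mult_le; [rewrite Rabs_pos_eq; lra | apply Rabs_le; nra]. }
    assert (B2 : Rabs (N ^ 2 * h t ^ 2 + 2 * a + a ^ 2 * h t) <= N ^ 2 + 2 * X + X ^ 2).
    { eapply Rle_trans; [apply Rabs_triang|].
      apply Rplus_le_compat; [eapply Rle_trans; [apply Rabs_triang|]; apply Rplus_le_compat|].
      - rewrite <- (Rmult_1_r (N ^ 2)) at 2.
        apply Rabs_mult_le; rewrite Rabs_pos_eq; nra.
      - rewrite Rabs_mult, (Rabs_pos_eq 2) by lra. lra.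
      - rewrite <- (Rmult_1_r (X ^ 2)). apply Rabs_mult_le.
        + rewrite <- RPow_abs. apply pow_incr. split; [apply Rabs_pos | exact HaX].
        + rewrite Rabs_pos_eq; lra. }
    assert (B3 : Rabs (2 * N * (1 + a * h t)) <= 2 * N * 2).
    { apply Rabs_mult_le; rewrite Rabs_pos_eq; lra. }
    assert (B4 : Rabs (N * ((N - 1) * h t)) <= N * (N + 1)).
    { apply Rabs_mult_le; [rewrite Rabs_pos_eq; lra|].
      rewrite <- (Rmult_1_r (N + 1)). apply Rabs_mult_le; [apply Rabs_le; lra|].
      rewrite Rabs_pos_eq; lra. }
    eapply Rle_trans.
    { apply (Rabs_sum5_le _ _ _ _ _ _ _ _ _ _ Hop
        (Rabs_mult_le _ _ _ _ B1 (K1 a Ha)) (Rabs_mult_le _ _ _ _ B2 (K2 a Ha))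
        (Rabs_mult_le _ _ _ _ B3 (K3 a Ha)) (Rabs_mult_le _ _ _ _ B4 (K4 a Ha))). }
    apply Req_le. ring.
Qed.

End APriori.

(** An interpolation in the manner of Landau: [u1 t a] differs by at most [C d] from a difference
    quotient of [u t] with step d. The choice of d makes [C d <= eps/2], and values of size
    [eps d / 4] at both ends make the quotient at most [eps/2]. *)
Lemma derive_pointwise_zero (u u1 u2 : T -> R -> R) (a : R) :
  (forall eps, 0 < eps -> forall x, Fl (fun t => Rabs (u t x) <= eps)) ->
  Fl (fun t => forall x, a <= x <= a + 1 ->
        is_derive (u t) x (u1 t x) /\ is_derive (u1 t) x (u2 t x)) ->
  big_O 0 a (a + 1) u2 ->
  forall eps, 0 < eps -> Fl (fun t => Rabs (u1 t a) <= eps).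
Proof.
  intros Hu Hd H2 eps Heps. destruct (big_O_pos _ _ _ _ H2) as (C & HC & HC2).
  set (d := Rmin 1 (eps / (2 * C))).
  assert (Hd0 : 0 < d) by (apply Rmin_pos; [lra | apply Rdiv_lt_0_compat; lra]).
  assert (Hd1 : d <= 1) by apply Rmin_l.
  assert (HdC : C * d <= eps / 2).
  { replace (eps / 2) with (C * (eps / (2 * C))) by (field; lra).
    apply Rmult_le_compat_l; [lra | apply Rmin_r]. }
  assert (He : 0 < eps * d / 4) by nra.
  generalize (filter_and _ _ Hd (filter_and _ _ HC2
    (filter_and _ _ (Hu _ He a) (Hu _ He (a + d))))).
  apply filter_imp. intros t (K & K2 & K3 & K4).
  destruct (mean_value (u t) (u1 t) a (a + d)) as (xi & Hxi & Exi); [lra| |].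
  { intros x Hx. apply K. lra. }
  replace (a + d - a) with d in Exi by ring.
  assert (E1 : Rabs (u1 t xi) <= eps / 2).
  { apply Rmult_le_reg_r with d; [exact Hd0|].
    rewrite <- (Rabs_pos_eq d) at 1 by lra. rewrite <- Rabs_mult, <- Exi.
    pose proof (Rabs_triang (u t (a + d)) (- u t a)) as Tr. rewrite Rabs_Ropp in Tr.
    unfold Rminus. lra. }
  assert (E2 : Rabs (u1 t a - u1 t xi) <= C * Rabs (a - xi)).
  { apply (mean_value_bound (u1 t) (u2 t) a (a + d)).
    - intros x Hx. apply K. lra.
    - intros x Hx. specialize (K2 x ltac:(lra)). simpl in K2. lra.
    - lra.
    - lra. }
  assert (C * Rabs (a - xi) <= C * d).
  { apply Rmult_le_compat_l; [lra|]. apply Rabs_le. lra. }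
  pose proof (Rabs_triang (u1 t a - u1 t xi) (u1 t xi)) as Tr.
  replace (u1 t a - u1 t xi + u1 t xi) with (u1 t a) in Tr by ring. lra.
Qed.

Fixpoint partial (m : nat) (t : T) (j : nat) (a : R) : R :=
  match m with
  | O => 0
  | S k => partial k t j a + h t ^ k * g k j a
  end.

(* [bessel_op h] applied to the first [m] terms is
   [sum_(k < m) h^k residual k + h^m (fst (tails m) + h snd (tails m))]. *)
Fixpoint tails (m : nat) : (nat -> R -> R) * (nat -> R -> R) :=
  match m with
  | O => (fun _ _ => 0, fun _ _ => 0)
  | S k => (fun l a => snd (tails k) l a + op1 (g k) l a, op2 (g k))
  end.

(** The coefficient of h^k in the formal series: unfolding [tails] gives [op0 (g k) + op1 (g (k-1))
    + op2 (g (k-2))], where terms of negative index are zero. *)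
Definition residual (k l : nat) (a : R) : R := fst (tails k) l a + op0 (g k) l a.

Lemma tower_0 a : tower (fun _ _ => 0) a.
Proof. intros j. apply @is_derive_const. Qed.

Lemma tails_tower m a : tower (fst (tails m)) a /\ tower (snd (tails m)) a.
Proof.
  induction m as [|m [IH1 IH2]]; simpl; split; try apply tower_0.
  - apply (tower_plus (snd (tails m)) (op1 (g m))); [exact IH2|]. apply op1_tower, g_tower.
  - apply op2_tower, g_tower.
Qed.

Lemma residual_tower k a : tower (residual k) a.
Proof.
  apply (tower_plus (fst (tails k)) (op0 (g k))); [apply tails_tower|].
  apply op0_tower, g_tower.
Qed.

Lemma partial_tower m t a : tower (partial m t) a.
Proof.
  induction m as [|m IH]; [apply tower_0|].
  apply (tower_plus (partial m t) (fun j x => h t ^ m * g m j x)); [exact IH|].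
  apply tower_scal, g_tower.
Qed.

Lemma bessel_op_partial m t l a :
  (forall k, (k < m)%nat -> residual k l a = 0) ->
  bessel_op (h t) (partial m t) l a
  = h t ^ m * (fst (tails m) l a + h t * snd (tails m) l a).
Proof.
  induction m as [|m IH]; intros Hres.
  - simpl. unfold bessel_op, op0, op1, op2. simpl. ring.
  - specialize (IH (fun k Hk => Hres k ltac:(lia))). specialize (Hres m ltac:(lia)).
    unfold residual in Hres.
    transitivity (bessel_op (h t) (partial m t) l a + h t ^ m * bessel_op (h t) (g m) l a).
    + unfold bessel_op, op0, op1, op2. simpl. ring.
    + rewrite IH. simpl. unfold bessel_op.
      replace (op0 (g m) l a) with (- fst (tails m) l a) by lra. ring.
Qed.

Hypothesis pointwise : forall m a, big_O m a a (fun t x => F t 0%nat x - partial m t 0%nat x).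

Definition remainder (m : nat) (t : T) (j : nat) (a : R) : R := F t j a - partial m t j a.

Lemma F_eq_all A B l :
  Fl (fun t => forall a, A <= a <= B -> bessel_op (h t) (F t) l a = 0).
Proof.
  generalize (filter_and _ _ (F_tower (A - 1) (B + 1)) (F_eq (A - 1) (B + 1))).
  apply filter_imp. intros t [H1 H2] a Ha.
  apply (tower_zero (bessel_op (h t) (F t)) (A - 1) (B + 1)).
  - intros x Hx. apply bessel_op_tower, H1. lra.
  - intros x Hx. apply H2. lra.
  - lra.
Qed.

Lemma remainder_tower m A B : Fl (fun t => forall a, A <= a <= B -> tower (remainder m t) a).
Proof.
  generalize (F_tower A B). apply filter_imp. intros t H a Ha j.
  apply @is_derive_minus; [now apply H | apply partial_tower].
Qed.

Lemma bessel_op_remainder m A B l :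
  (forall k a, (k < m)%nat -> residual k l a = 0) ->
  Fl (fun t => forall a, A <= a <= B -> bessel_op (h t) (remainder m t) l a
        = - (h t ^ m * (fst (tails m) l a + h t * snd (tails m) l a))).
Proof.
  intros Hres. generalize (F_eq_all A B l). apply filter_imp. intros t H a Ha.
  rewrite <- bessel_op_partial by (intros; now apply Hres).
  specialize (H a Ha).
  transitivity (bessel_op (h t) (F t) l a - bessel_op (h t) (partial m t) l a);
    [|rewrite H; ring].
  unfold bessel_op, op0, op1, op2, remainder. ring.
Qed.

(** Once the first m residuals vanish, the operator sends the remainder to [- h^m] times the tails,
    which is uniformly O(h^m); the pointwise hypothesis and [a_priori] do the rest. *)
Lemma remainder_big_O m A B l :
  (forall k l a, (k < m)%nat -> residual k l a = 0) -> big_O m A B (fun t => remainder m t l).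
Proof.
  intros Hres. apply a_priori.
  - apply remainder_tower.
  - clear A B l. intros A B l.
    apply big_O_ext with (fun t a => h t ^ m * (- fst (tails m) l a)
                                     + h t ^ (S m) * (- snd (tails m) l a)).
    + generalize (bessel_op_remainder m A B l (fun k a => Hres k l a)).
      apply filter_imp. intros t H a Ha. rewrite H by exact Ha. simpl. ring.
    + apply big_O_plus; apply big_O_power_mult; try lia; intros x; apply @ex_derive_opp.
      * exists (fst (tails m) (S l) x). apply (proj1 (tails_tower m x)).
      * exists (snd (tails m) (S l) x). apply (proj2 (tails_tower m x)).
  - intros a. apply pointwise.
Qed.

Lemma residual_step m :
  (forall k l a, (k < m)%nat -> residual k l a = 0) -> forall a, residual m 0%nat a = 0.
Proof.
  intros Hres a.
  (* Up to the factor [h^(-m)] this is the remainder after m + 1 terms. It is therefore pointwise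
     O(h), while stage m only bounds its derivatives. *)
  set (e := fun t j x => / h t ^ m * remainder m t j x - g m j x).
  assert (e_tow : forall A B, Fl (fun t => forall x, A <= x <= B -> tower (e t) x)).
  { intros A B. generalize (remainder_tower m A B). apply filter_imp.
    intros t H x Hx j. apply @is_derive_minus; [|apply g_tower].
    apply is_derive_Rscal. now apply H. }
  assert (e_bd : forall A B j, big_O 0 A B (fun t => e t j)).
  { intros A B j.
    apply big_O_ext with (fun t x => / h t ^ m * remainder m t j x + h t ^ 0 * (- g m j x)).
    { apply filter_forall. intros t x _. unfold e. simpl. ring. }
    apply big_O_plus.
    - destruct (remainder_big_O m A B j Hres) as [C HC]. exists C.
      generalize (filter_and _ _ h_pos HC). apply filter_imp. intros t [Ht H] x Hx.
      assert (Hp : 0 < h t ^ m) by now apply pow_lt.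
      rewrite Rabs_mult, Rabs_inv, (Rabs_pos_eq (h t ^ m)) by lra.
      apply Rmult_le_reg_l with (h t ^ m); [exact Hp|].
      rewrite <- Rmult_assoc, Rinv_r, Rmult_1_l by lra. specialize (H x Hx). simpl. lra.
    - apply big_O_power_mult; [lia|]. intros x. apply @ex_derive_opp.
      exists (g m (S j) x). apply g_tower. }
  assert (e0 : forall eps, 0 < eps -> forall x, Fl (fun t => Rabs (e t 0%nat x) <= eps)).
  { intros eps Heps x.
    destruct (big_O_pos _ _ _ _ (pointwise (S m) x)) as (C & HC & H).
    assert (Hd : 0 < eps / C) by now apply Rdiv_lt_0_compat.
    generalize (filter_and _ _ h_pos (filter_and _ _ H (h_small _ Hd))).
    apply filter_imp. intros t (Ht & H1 & H2). specialize (H1 x ltac:(lra)).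
    assert (Hp : 0 < h t ^ m) by now apply pow_lt.
    replace (e t 0%nat x) with (/ h t ^ m * (F t 0%nat x - partial (S m) t 0%nat x))
      by (unfold e, remainder; simpl; field; lra).
    rewrite Rabs_mult, Rabs_inv, (Rabs_pos_eq (h t ^ m)) by lra.
    apply Rmult_le_reg_l with (h t ^ m); [exact Hp|].
    rewrite <- Rmult_assoc, Rinv_r, Rmult_1_l by lra.
    eapply Rle_trans; [exact H1|]. simpl.
    assert (C * h t <= eps).
    { replace eps with (C * (eps / C)) by (field; lra). apply Rmult_le_compat_l; lra. }
    replace (C * (h t * h t ^ m)) with (h t ^ m * (C * h t)) by ring.
    apply Rmult_le_compat_l; lra. }
  assert (e1 : forall eps, 0 < eps -> forall x, Fl (fun t => Rabs (e t 1%nat x) <= eps)).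
  { intros eps Heps x.
    apply (derive_pointwise_zero (fun t => e t 0%nat) (fun t => e t 1%nat)
             (fun t => e t 2%nat)); auto.
    generalize (e_tow x (x + 1)). apply filter_imp. intros t H y Hy.
    split; now apply H. }
  assert (e2 : forall eps, 0 < eps -> forall x, Fl (fun t => Rabs (e t 2%nat x) <= eps)).
  { intros eps Heps x.
    apply (derive_pointwise_zero (fun t => e t 1%nat) (fun t => e t 2%nat)
             (fun t => e t 3%nat)); auto.
    generalize (e_tow x (x + 1)). apply filter_imp. intros t H y Hy.
    split; now apply H. }
  apply Rabs_eq_0, Rle_antisym; [|apply Rabs_pos].
  apply Rle_plus_epsilon. intros eps Heps. rewrite Rplus_0_l.
  (* The residual does not depend on t, so a bound by [eps] that holds eventually holds outright,
     the filter being proper. *)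
  apply (filter_const (F := Fl)).
  (* X dominates all coefficients that occur, and [X >= 4]. The operator term costs at most
     [2 X^2 eta] and the two tail terms [2 X eta]; with [X^2 eta <= eps/4] the total stays below
     [eps]. *)
  set (c1 := fst (tails (S m)) 0%nat a). set (c2 := snd (tails (S m)) 0%nat a).
  set (X := 4 + 4 * Rabs a + a ^ 2 + Rabs c1 + Rabs c2).
  assert (HX : 0 < X).
  { unfold X. pose proof (Rabs_pos a). pose proof (Rabs_pos c1). pose proof (Rabs_pos c2). nra. }
  set (eta := Rmin 1 (eps / (4 * X ^ 2))).
  assert (Heta : 0 < eta) by (apply Rmin_pos; [lra | apply Rdiv_lt_0_compat; nra]).
  assert (HetaX : X ^ 2 * eta <= eps / 4).
  { replace (eps / 4) with (X ^ 2 * (eps / (4 * X ^ 2))) by (field; lra).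
    apply Rmult_le_compat_l; [nra | apply Rmin_r]. }
  generalize (filter_and _ _ (filter_and _ _ h_pos (h_small _ Heta))
    (filter_and _ _ (e0 _ Heta a) (filter_and _ _ (e1 _ Heta a) (filter_and _ _ (e2 _ Heta a)
     (bessel_op_remainder m a a 0 (fun k x => Hres k 0%nat x)))))).
  apply filter_imp. intros t ((Hh & Hh') & K0 & K1 & K2 & K3).
  specialize (K3 a ltac:(lra)).
  assert (Hp : 0 < h t ^ m) by now apply pow_lt.
  assert (Hh1 : h t <= 1) by (apply Rlt_le, Rlt_le_trans with eta; [exact Hh' | apply Rmin_l]).
  (* The equation for e, sorted by powers of h: the residual is the part of [- bessel_op e] that
     does not carry a factor h. The two zeros fit the shape of [Rabs_sum5_le]. *)
  assert (E : residual m 0%nat a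
              = - (bessel_op (h t) (e t) 0 a) - h t * c1 - h t * (h t * c2) - 0 - 0).
  { assert (E1 : bessel_op (h t) (e t) 0 a = / h t ^ m * bessel_op (h t) (remainder m t) 0 a
                                   - bessel_op (h t) (g m) 0 a)
      by (unfold bessel_op, op0, op1, op2, e; ring).
    rewrite E1, K3. unfold residual, c1, c2. simpl. unfold bessel_op. field. lra. }
  rewrite E.
  assert (HaX : Rabs a <= X - 1 /\ Rabs c1 <= X /\ Rabs c2 <= X).
  { unfold X. pose proof (Rabs_pos a). pose proof (Rabs_pos c1). pose proof (Rabs_pos c2). nra. }
  destruct HaX as (HaX & HcX1 & HcX2).
  assert (HX1 : 4 + 4 * Rabs a <= X).
  { unfold X. pose proof (Rabs_pos a). pose proof (Rabs_pos c1). pose proof (Rabs_pos c2). nra. }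
  assert (Bop : Rabs (bessel_op (h t) (e t) 0 a) <= 2 * (X ^ 2 * eta)).
  { rewrite bessel_op_eq. simpl INR. simpl pred.
    pose proof (Rabs_pos a) as Ha0.
    assert (Q1 : Rabs (1 + a * h t) <= 1 + Rabs a).
    { eapply Rle_trans; [apply Rabs_triang|]. rewrite Rabs_R1.
      apply Rplus_le_compat_l. rewrite <- (Rmult_1_r (Rabs a)).
      apply Rabs_mult_le; [lra | rewrite Rabs_pos_eq; lra]. }
    assert (P2 : Rabs ((1 + a * h t) ^ 2 * e t 2%nat a) <= (1 + Rabs a) ^ 2 * eta).
    { apply Rabs_mult_le; [|exact K2]. rewrite <- RPow_abs. apply pow_incr.
      split; [apply Rabs_pos | exact Q1]. }
    assert (P1 : Rabs (h t * (1 + a * h t) * e t 1%nat a) <= 1 * (1 + Rabs a) * eta).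
    { apply Rabs_mult_le; [|exact K1]. apply Rabs_mult_le; [rewrite Rabs_pos_eq; lra | exact Q1]. }
    assert (P0 : Rabs ((2 * a + a ^ 2 * h t) * e t 0%nat a) <= (2 * Rabs a + Rabs a ^ 2) * eta).
    { apply Rabs_mult_le; [|exact K0]. eapply Rle_trans; [apply Rabs_triang|].
      apply Rplus_le_compat; [rewrite Rabs_mult, (Rabs_pos_eq 2) by lra; lra|].
      rewrite <- (Rmult_1_r (Rabs a ^ 2)), RPow_abs.
      apply Rabs_mult_le; [lra | rewrite Rabs_pos_eq; lra]. }
    apply Rabs_le_between in P0, P1, P2.
    assert (Hpoly : (1 + Rabs a) ^ 2 * eta + 1 * (1 + Rabs a) * eta
                    + (2 * Rabs a + Rabs a ^ 2) * eta <= 2 * (X ^ 2 * eta)).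
    { replace ((1 + Rabs a) ^ 2 * eta + 1 * (1 + Rabs a) * eta
               + (2 * Rabs a + Rabs a ^ 2) * eta)
        with ((2 + 5 * Rabs a + 2 * Rabs a ^ 2) * eta) by ring.
      rewrite <- Rmult_assoc. apply Rmult_le_compat_r; [lra|].
      assert ((4 + 4 * Rabs a) ^ 2 <= X ^ 2) by (apply pow_incr; lra). nra. }
    apply Rabs_le. lra. }
  assert (B1 : Rabs (h t * c1) <= eta * X)
    by (apply Rabs_mult_le; [rewrite Rabs_pos_eq; lra | exact HcX1]).
  assert (B2 : Rabs (h t * (h t * c2)) <= eta * (1 * X)).
  { apply Rabs_mult_le; [rewrite Rabs_pos_eq; lra|].
    apply Rabs_mult_le; [rewrite Rabs_pos_eq; lra | exact HcX2]. }
  rewrite <- Rabs_Ropp in Bop.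
  pose proof (Rabs_sum5_le _ _ _ _ _ _ _ _ _ _ Bop B1 B2
    (Req_le _ _ Rabs_R0) (Req_le _ _ Rabs_R0)) as S5.
  assert (4 * X <= X ^ 2) by (pose proof (Rabs_pos a); nra).
  assert (4 * X * eta <= X ^ 2 * eta) by (apply Rmult_le_compat_r; lra). lra.
Qed.

Lemma residual_zero k l a : residual k l a = 0.
Proof.
  enough (H : forall m k l a, (k < m)%nat -> residual k l a = 0) by (apply (H (S k)); lia).
  clear k l a. induction m as [|m IH]; intros k l a Hk; [lia|].
  destruct (Nat.eq_dec k m) as [-> | Hne]; [|apply IH; lia].
  (* [residual_step] concerns l = 0 at every point; differentiation gives the other l. *)
  apply (tower_zero (residual m) (a - 1) (a + 1)); [|intros; now apply residual_step | lra].
  intros; apply residual_tower.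
Qed.

Lemma uniform_expansion m A B l : big_O m A B (fun t => remainder m t l).
Proof. apply remainder_big_O. intros; apply residual_zero. Qed.

End Expansion.

(** * The reciprocal Gamma function *)

Definition euler_seq (x : R) (n : nat) : R :=
  rising x (S n) / (INR (fact n) * Rpower (INR n) x).

Lemma rising_S_l x n : rising x (S n) = x * rising (x + 1) n.
Proof.
  induction n as [|n IH]; [simpl; ring|].
  change (rising x (S (S n))) with (rising x (S n) * (x + INR (S n))).
  rewrite IH. simpl rising. rewrite S_INR. ring.
Qed.

Lemma rising_pos x n : 0 < x -> 0 < rising x n.
Proof.
  intros Hx. induction n as [|n IH]; simpl; [lra|].
  apply Rmult_lt_0_compat; [exact IH | pose proof (pos_INR n); lra].
Qed.

Lemma rising_1 n : rising 1 n = INR (fact n).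
Proof.
  induction n as [|n IH]; simpl rising; [reflexivity|].
  rewrite IH, fact_simpl, mult_INR, S_INR. ring.
Qed.

(** Used with 1/Gamma(x) = x/Gamma(x + 1) to extend facts from the positive half-line, where
    logarithms are available, to all real x. *)
Lemma down_induction (P : R -> Prop) :
  (forall x, 0 < x -> P x) -> (forall x, P (x + 1) -> P x) -> forall x, P x.
Proof.
  intros Hpos Hstep.
  assert (H : forall n x, - INR n < x -> P x).
  { induction n as [|n IH]; intros x Hx.
    - apply Hpos. simpl in Hx. lra.
    - apply Hstep, IH. rewrite S_INR in Hx. lra. }
  intros x. destruct (nfloor_ex (Rabs x) (Rabs_pos x)) as (n & Hn & Hn').
  apply (H (S n)). rewrite S_INR. pose proof (Rle_abs (- x)) as K. rewrite Rabs_Ropp in K. lra.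
Qed.

Fixpoint log_rising (x : R) (n : nat) : R :=
  match n with
  | O => 0
  | S m => log_rising x m + ln (x + INR m)
  end.

Fixpoint inv_sum (x : R) (n : nat) : R :=
  match n with
  | O => 0
  | S m => inv_sum x m + / (x + INR m)
  end.

Lemma exp_log_rising x n : 0 < x -> exp (log_rising x n) = rising x n.
Proof.
  intros Hx. induction n as [|n IH]; simpl; [apply exp_0|].
  rewrite exp_plus, IH, exp_ln; [reflexivity | pose proof (pos_INR n); lra].
Qed.

Lemma is_derive_log_rising x n :
  0 < x -> is_derive (fun y => log_rising y n) x (inv_sum x n).
Proof.
  intros Hx. induction n as [|n IH]; simpl; [apply @is_derive_const|].
  apply is_derive_Rplus; [exact IH|].
  auto_derive; [pose proof (pos_INR n); lra | ring].
Qed.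

Definition log_euler (n : nat) (x : R) : R :=
  log_rising x (S n) - ln (INR (fact n)) - x * ln (INR n).

(** Its limit is the derivative of log(1/Gamma), that is, minus the digamma function. *)
Definition dlog_euler (n : nat) (x : R) : R := inv_sum x (S n) - ln (INR n).

Lemma exp_log_euler n x : 0 < x -> exp (log_euler n x) = euler_seq x n.
Proof.
  intros Hx. unfold log_euler, euler_seq, Rpower, Rminus.
  rewrite !exp_plus, !exp_Ropp, exp_log_rising, exp_ln by (exact Hx || apply INR_fact_lt_0).
  unfold Rdiv. rewrite Rinv_mult. ring.
Qed.

Lemma is_derive_log_euler n x : 0 < x -> is_derive (log_euler n) x (dlog_euler n x).
Proof.
  intros Hx. unfold log_euler, dlog_euler.
  apply is_derive_val with (inv_sum x (S n) + (- ln (INR n))); [|ring].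
  apply is_derive_ext with
    (fun y => log_rising y (S n) + (- ln (INR (fact n)) - y * ln (INR n))).
  { intros; simpl; ring. }
  apply is_derive_Rplus; [now apply is_derive_log_rising|].
  auto_derive; [easy | ring].
Qed.

Lemma ln_le_minus_1 y : 0 < y -> ln y <= y - 1.
Proof. intros Hy. pose proof (exp_ineq1_le (ln y)) as H. rewrite exp_ln in H by exact Hy. lra. Qed.

Lemma ln_succ_bounds (y : R) : 0 < y -> / (y + 1) <= ln (y + 1) - ln y <= / y.
Proof.
  intros Hy. split.
  - pose proof (ln_le_minus_1 (y / (y + 1)) ltac:(apply Rdiv_lt_0_compat; lra)) as H.
    rewrite ln_div in H by lra.
    replace (y / (y + 1) - 1) with (- / (y + 1)) in H by (field; lra). lra.
  - pose proof (ln_le_minus_1 ((y + 1) / y) ltac:(apply Rdiv_lt_0_compat; lra)) as H.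
    rewrite ln_div in H by lra.
    replace ((y + 1) / y - 1) with (/ y) in H by (field; lra). lra.
Qed.

(** One step changes the value by [/ (x + n + 1) - (ln (n + 1) - ln n)]. Since the logarithmic
    difference lies between [/ (n + 1)] and [/ n], this is nonpositive and at least
    [- (1 + B) (/ n - / (n + 1))], which telescopes; B in place of x makes it uniform. *)
Lemma dlog_euler_increment B x m k :
  0 < x < B -> (1 <= m)%nat ->
  - (1 + B) * (/ INR m - / INR (m + k)) <= dlog_euler (m + k) x - dlog_euler m x <= 0.
Proof.
  intros Hx Hm. apply (le_INR 1 m) in Hm. simpl in Hm.
  induction k as [|k IH].
  - rewrite Nat.add_0_r. lra.
  - rewrite Nat.add_succ_r. set (n := (m + k)%nat) in *.
    assert (Hn : 1 <= INR n) by (unfold n; rewrite plus_INR; pose proof (pos_INR k); lra).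
    assert (E : dlog_euler (S n) x - dlog_euler n x
                = / (x + (INR n + 1)) - (ln (INR n + 1) - ln (INR n))).
    { unfold dlog_euler. change (inv_sum x (S (S n))) with
        (inv_sum x (S n) + / (x + INR (S n))). rewrite S_INR. ring. }
    pose proof (ln_succ_bounds (INR n) ltac:(lra)) as HL.
    assert (H1 : / (x + (INR n + 1)) <= / (INR n + 1)) by (apply Rinv_le_contravar; lra).
    assert (H2 : / INR n - / (x + (INR n + 1)) <= (1 + B) * (/ INR n - / (INR n + 1))).
    { replace (/ INR n - / (x + (INR n + 1)))
        with ((1 + x) * (/ INR n * / (x + (INR n + 1)))) by (field; lra).
      replace (/ INR n - / (INR n + 1)) with (/ INR n * / (INR n + 1)) by (field; lra).
      assert (0 < / INR n) by (apply Rinv_0_lt_compat; lra).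
      assert (0 < / (x + (INR n + 1))) by (apply Rinv_0_lt_compat; lra).
      apply Rmult_le_compat; [lra | nra | lra |].
      apply Rmult_le_compat_l; lra. }
    rewrite S_INR. lra.
Qed.

Lemma dlog_euler_cauchy B : unif_cauchy (fun x => 0 < x < B) dlog_euler.
Proof.
  intros eps.
  destruct (nfloor_ex ((1 + Rabs B) / eps)) as (N & _ & HN).
  { apply Rlt_le, Rdiv_lt_0_compat; [pose proof (Rabs_pos B); lra | apply cond_pos]. }
  assert (HNe : (1 + Rabs B) * / (INR N + 1) <= eps).
  { pose proof (pos_INR N). pose proof (cond_pos eps).
    apply Rmult_le_reg_r with ((INR N + 1) * / eps).
    - apply Rmult_lt_0_compat; [lra | now apply Rinv_0_lt_compat].
    - replace ((1 + Rabs B) * / (INR N + 1) * ((INR N + 1) * / eps))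
        with ((1 + Rabs B) / eps) by (field; lra).
      replace (eps * ((INR N + 1) * / eps)) with (INR N + 1) by (field; lra). lra. }
  assert (HW : forall n m x, (S N <= m)%nat -> (m <= n)%nat -> 0 < x < B ->
                 Rabs (dlog_euler n x - dlog_euler m x) <= eps).
  { intros n m x Hm Hn Hx.
    pose proof (dlog_euler_increment B x m (n - m) Hx ltac:(lia)) as H.
    replace (m + (n - m))%nat with n in H by lia.
    apply le_INR in Hm. rewrite S_INR in Hm. apply le_INR in Hn. pose proof (pos_INR N).
    assert (H1 : / INR m <= / (INR N + 1)) by (apply Rinv_le_contravar; lra).
    assert (H2 : 0 < / INR n) by (apply Rinv_0_lt_compat; lra).
    pose proof (Rle_abs B).
    assert ((1 + B) * (/ INR m - / INR n) <= (1 + Rabs B) * / (INR N + 1)).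
    { apply Rle_trans with ((1 + B) * / (INR N + 1)).
      - apply Rmult_le_compat_l; lra.
      - apply Rmult_le_compat_r; [|lra]. apply Rlt_le, Rinv_0_lt_compat; lra. }
    apply Rabs_le. pose proof (cond_pos eps). lra. }
  exists (S N). intros n m x Hn Hm Hx.
  destruct (Nat.le_ge_cases m n).
  - now apply HW.
  - rewrite Rabs_minus_sym. now apply HW.
Qed.

Lemma log_euler_1_lim : is_lim_seq (fun n => log_euler n 1) 0.
Proof.
  assert (H : forall n, (1 <= n)%nat -> 0 <= log_euler n 1 <= / INR n).
  { intros n Hn. apply (le_INR 1 n) in Hn. simpl in Hn.
    (* At x = 1 Euler's quotient is (n + 1)! / (n! n) = (n + 1) / n. *)
    assert (E : log_euler n 1 = ln (INR n + 1) - ln (INR n)).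
    { apply exp_inv. rewrite exp_log_euler by lra. unfold euler_seq.
      rewrite rising_1, fact_simpl, mult_INR, S_INR, Rpower_1 by lra.
      rewrite <- ln_div, exp_ln by (try apply Rdiv_lt_0_compat; lra).
      field. split; [lra | apply INR_fact_neq_0]. }
    pose proof (ln_succ_bounds (INR n) ltac:(lra)).
    assert (0 < / (INR n + 1)) by (apply Rinv_0_lt_compat; lra). lra. }
  apply is_lim_seq_le_le_loc with (fun _ => 0) (fun n => / INR n).
  - exists 1%nat. exact H.
  - apply is_lim_seq_const.
  - apply (is_lim_seq_inv INR p_infty); [apply is_lim_seq_INR | easy].
Qed.

Lemma log_euler_lim x :
  0 < x -> is_lim_seq (fun n => log_euler n x) (real (Lim_seq (fun n => log_euler n x))).
Proof.
  intros Hx. apply (ex_lim_of_derive 0 (x + 2) log_euler dlog_euler) with (c := 1); try lra.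
  - intros; apply is_derive_log_euler; lra.
  - apply dlog_euler_cauchy.
  - exists 0. apply log_euler_1_lim.
Qed.

Lemma ex_derive_log_euler_lim x :
  0 < x -> ex_derive (fun y => real (Lim_seq (fun n => log_euler n y))) x.
Proof.
  intros Hx. eexists.
  apply (is_derive_lim 0 (x + 2) log_euler dlog_euler); try lra.
  - intros; apply is_derive_log_euler; lra.
  - apply dlog_euler_cauchy.
  - intros; apply log_euler_lim; lra.
Qed.

Lemma euler_seq_lim_pos x :
  0 < x -> is_lim_seq (euler_seq x) (exp (real (Lim_seq (fun n => log_euler n x)))).
Proof.
  intros Hx. apply is_lim_seq_ext with (fun n => exp (log_euler n x)).
  - intros n. now apply exp_log_euler.
  - apply (is_lim_seq_continuous exp); [|now apply log_euler_lim].
    apply derivable_continuous_pt, derivable_pt_exp.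
Qed.

(** The functional equation at finite n, with the correction factor n / (n + x + 1), which tends to
    1. *)
Lemma euler_seq_S x n :
  (1 <= n)%nat -> x + INR n + 1 <> 0 ->
  euler_seq x n = x * euler_seq (x + 1) n * / (1 + (x + 1) * / INR n).
Proof.
  intros Hn Hx. apply (le_INR 1 n) in Hn. simpl in Hn. unfold euler_seq.
  rewrite rising_S_l. simpl rising. rewrite Rpower_plus, Rpower_1 by lra.
  field. repeat split; try lra.
  - apply Rgt_not_eq, exp_pos.
  - apply INR_fact_neq_0.
Qed.

Lemma euler_factor_lim x : is_lim_seq (fun n => / (1 + (x + 1) * / INR n)) 1.
Proof.
  replace (Finite 1) with (Rbar_inv (1 + (x + 1) * 0)) by (simpl; f_equal; field).
  apply is_lim_seq_inv; [|simpl; intros E; injection E; lra].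
  apply is_lim_seq_plus'; [apply is_lim_seq_const|].
  apply (is_lim_seq_scal_l _ (x + 1) 0).
  apply (is_lim_seq_inv INR p_infty); [apply is_lim_seq_INR | easy].
Qed.

Lemma euler_seq_lim_S x (l : R) :
  is_lim_seq (euler_seq (x + 1)) l -> is_lim_seq (euler_seq x) (x * l).
Proof.
  intros H.
  apply is_lim_seq_ext_loc with (fun n => x * euler_seq (x + 1) n * / (1 + (x + 1) * / INR n)).
  - destruct (nfloor_ex (Rabs x) (Rabs_pos x)) as (N & _ & HN).
    exists (S N). intros n Hn. symmetry. apply euler_seq_S; [lia|].
    apply le_INR in Hn. rewrite S_INR in Hn.
    pose proof (Rle_abs (- x)) as K. rewrite Rabs_Ropp in K. lra.
  - replace (x * l) with (x * l * 1) by ring.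
    apply is_lim_seq_mult'; [|apply euler_factor_lim].
    now apply (is_lim_seq_scal_l _ x l).
Qed.

Lemma rGamma_lim x : is_lim_seq (euler_seq x) (rGamma x).
Proof.
  enough (H : ex_finite_lim_seq (euler_seq x)) by exact (Lim_seq_correct' _ H).
  revert x. apply down_induction.
  - intros x Hx. eexists. now apply euler_seq_lim_pos.
  - intros x [l Hl]. exists (x * l). now apply euler_seq_lim_S.
Qed.

Lemma rGamma_eq x (l : R) : is_lim_seq (euler_seq x) l -> rGamma x = l.
Proof.
  intros H. pose proof (is_lim_seq_unique _ _ H) as E.
  unfold rGamma. unfold euler_seq in E. now rewrite E.
Qed.

Lemma rGamma_S x : rGamma x = x * rGamma (x + 1).
Proof. apply rGamma_eq, euler_seq_lim_S, rGamma_lim. Qed.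

Lemma rGamma_1 : rGamma 1 = 1.
Proof.
  rewrite (rGamma_eq _ _ (euler_seq_lim_pos 1 Rlt_0_1)).
  rewrite (is_lim_seq_unique _ _ log_euler_1_lim). apply exp_0.
Qed.

Lemma ex_derive_rGamma x : ex_derive rGamma x.
Proof.
  revert x. apply down_induction.
  - intros x Hx.
    apply ex_derive_ext_loc with (fun y => exp (real (Lim_seq (fun n => log_euler n y)))).
    + exists (mkposreal x Hx). intros y Hy. symmetry. apply rGamma_eq, euler_seq_lim_pos.
      apply Rabs_def2 in Hy. unfold minus, plus, opp in Hy. simpl in Hy. lra.
    + apply (ex_derive_comp exp); [|now apply ex_derive_log_euler_lim].
      apply ex_derive_Reals_1, derivable_pt_exp.
  - intros x Hx. apply ex_derive_ext with (fun y => y * rGamma (y + 1)).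
    + intros y. symmetry. apply rGamma_S.
    + auto_derive. exact Hx.
Qed.

Lemma rGamma_INR n : rGamma (INR n + 1) = / INR (fact n).
Proof.
  induction n as [|n IH].
  - simpl. rewrite Rplus_0_l, rGamma_1. field.
  - rewrite fact_simpl, mult_INR, S_INR, Rinv_mult, <- IH.
    rewrite (rGamma_S (INR n + 1)). field. pose proof (pos_INR n). lra.
Qed.

Lemma rGamma_opp_INR n : rGamma (- INR n) = 0.
Proof.
  induction n as [|n IH].
  - rewrite rGamma_S. simpl. ring.
  - rewrite rGamma_S, S_INR. replace (- (INR n + 1) + 1) with (- INR n) by ring.
    rewrite IH. ring.
Qed.

Lemma rGamma_shift x n : rGamma x = rising x n * rGamma (x + INR n).
Proof.
  induction n as [|n IH]; simpl rising; rewrite ?S_INR.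
  - simpl. rewrite Rplus_0_r. ring.
  - rewrite IH, (rGamma_S (x + INR n)), Rplus_assoc. ring.
Qed.

(** * The Bessel function of the first kind *)

Definition entire_coeff (a : nat -> R) : Prop :=
  exists C, forall k, Rabs (a k) <= C / INR (fact k).

Lemma entire_coeff_CV a : entire_coeff a -> CV_radius a = p_infty.
Proof.
  intros [C HC].
  destruct (CV_radius_bounded a) as [Hub _].
  assert (H : forall r, exists M, forall n, Rabs (a n * r ^ n) <= M).
  { intros r.
    assert (Hex : ex_series (fun n => / INR (fact n) * Rabs r ^ n)).
    { apply (ex_series_ext (fun n => scal (Rabs r ^ n) (/ INR (fact n)))).
      - intros n. unfold scal; simpl; unfold mult; simpl. ring.
      - eexists. apply (is_exp_Reals (Rabs r)). }
    destruct (filterlim_bounded (fun n => / INR (fact n) * Rabs r ^ n)) as [M HM].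
    { exists 0. exact (ex_series_lim_0 _ Hex). }
    exists (Rabs C * M). intros n. rewrite Rabs_mult, <- RPow_abs.
    specialize (HM n). specialize (HC n).
    assert (Hr : 0 <= Rabs r ^ n) by apply pow_le, Rabs_pos.
    assert (Hf : 0 < / INR (fact n)) by (apply Rinv_0_lt_compat, INR_fact_lt_0).
    apply Rle_trans with (Rabs C * (/ INR (fact n) * Rabs r ^ n)).
    - rewrite <- Rmult_assoc. apply Rmult_le_compat_r; [exact Hr|].
      eapply Rle_trans; [exact HC|]. apply Rmult_le_compat_r; [lra | apply Rle_abs].
    - apply Rmult_le_compat_l; [apply Rabs_pos|].
      eapply Rle_trans; [apply Rle_abs | exact HM]. }
  (* Every [r] is an admissible bound, so the least upper bound can be neither finite nor minus
     infinity. *)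
  destruct (CV_radius a) as [r | |].
  - exfalso. pose proof (Hub (r + 1) (H (r + 1))) as K. simpl in K. lra.
  - reflexivity.
  - exfalso. exact (Hub 0 (H 0)).
Qed.

Lemma entire_ex_pseries a x : CV_radius a = p_infty -> ex_pseries a x.
Proof. intros H. apply CV_radius_inside. now rewrite H. Qed.

Lemma entire_ex_series a x : CV_radius a = p_infty -> ex_series (fun k => a k * x ^ k).
Proof.
  intros H. apply (ex_series_ext (fun n => scal (x ^ n) (a n))).
  - intros n. unfold scal; simpl; unfold mult; simpl. ring.
  - exact (entire_ex_pseries a x H).
Qed.

Lemma entire_is_derive a x :
  CV_radius a = p_infty -> is_derive (PSeries a) x (PSeries (PS_derive a) x).
Proof. intros H. apply is_derive_PSeries. now rewrite H. Qed.

Lemma entire_PS_derive a : CV_radius a = p_infty -> CV_radius (PS_derive a) = p_infty.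
Proof. intros H. now rewrite CV_radius_derive. Qed.

Lemma smooth_on_PSeries D n a : CV_radius a = p_infty -> smooth_on D n (PSeries a).
Proof.
  revert a; induction n as [|n IH]; intros a Ha; [easy|].
  exists (PSeries (PS_derive a)). split.
  - intros; now apply entire_is_derive.
  - now apply IH, entire_PS_derive.
Qed.

Definition bessel_coeff (s : R) (k : nat) : R :=
  (-1) ^ k * rGamma (s + INR k + 1) / INR (fact k).

Lemma rGamma_bounded x : exists C, forall k, Rabs (rGamma (x + INR k)) <= C.
Proof.
  assert (Hstep : forall x, (exists C, forall k, Rabs (rGamma (x + 1 + INR k)) <= C) ->
            exists C, forall k, Rabs (rGamma (x + INR k)) <= C).
  { clear x. intros x [C HC]. exists (Rmax C (Rabs (rGamma x))). intros [|k].
    - simpl. rewrite Rplus_0_r. apply Rmax_r.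
    - eapply Rle_trans; [|apply Rmax_l]. rewrite S_INR.
      replace (x + (INR k + 1)) with (x + 1 + INR k) by ring. apply HC. }
  revert x. apply down_induction; [|exact Hstep].
  (* Moving the base point to x + 1 makes every further factor [x + 1 + k] at least 1, so the values
     decrease in absolute value. *)
  intros x Hx. apply Hstep. exists (Rabs (rGamma (x + 1))).
  induction k as [|k IH]; [simpl; rewrite Rplus_0_r; lra|].
  rewrite S_INR, <- Rplus_assoc. rewrite rGamma_S, Rabs_mult in IH.
  pose proof (pos_INR k). pose proof (Rabs_pos (rGamma (x + 1 + INR k + 1))).
  rewrite (Rabs_pos_eq (x + 1 + INR k)) in IH by lra. nra.
Qed.

Lemma bessel_coeff_CV s : CV_radius (bessel_coeff s) = p_infty.
Proof.
  apply entire_coeff_CV. destruct (rGamma_bounded (s + 1)) as [C HC].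
  exists C. intros k. unfold bessel_coeff, Rdiv.
  rewrite !Rabs_mult, pow_1_abs, Rmult_1_l, Rabs_inv, (Rabs_pos_eq (INR (fact k)))
    by apply pos_INR.
  apply Rmult_le_compat_r; [apply Rlt_le, Rinv_0_lt_compat, INR_fact_lt_0|].
  replace (s + INR k + 1) with (s + 1 + INR k) by ring. apply HC.
Qed.

Lemma bessel_coeff_S s k :
  (INR k + 1) * (s + INR k + 1) * bessel_coeff s (S k) = - bessel_coeff s k.
Proof.
  unfold bessel_coeff. rewrite (rGamma_S (s + INR k + 1)), fact_simpl, mult_INR, S_INR.
  rewrite <- Rplus_assoc. simpl pow. field.
  split; [apply INR_fact_neq_0 | pose proof (pos_INR k); lra].
Qed.

(** Bessel's equation for (z/2)^s f((z/2)^2) becomes w f'' + (s + 1) f' + f = 0. The coefficient of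
    w^k is (k + 1)(s + k + 1) c_(k+1) + c_k, which is the recurrence [bessel_coeff_S]. *)
Lemma bessel_series_ode s w :
  w * PSeries (PS_derive (PS_derive (bessel_coeff s))) w
  + (s + 1) * PSeries (PS_derive (bessel_coeff s)) w + PSeries (bessel_coeff s) w = 0.
Proof.
  set (c := bessel_coeff s). set (d1 := PS_derive c). set (d2 := PS_derive d1).
  assert (Hc : CV_radius c = p_infty) by apply bessel_coeff_CV.
  assert (H1 : CV_radius d1 = p_infty) by now apply entire_PS_derive.
  assert (H2 : CV_radius d2 = p_infty) by now apply entire_PS_derive.
  rewrite <- (PSeries_incr_1 d2), <- (PSeries_scal (s + 1) d1).
  assert (X1 : ex_pseries (PS_incr_1 d2) w).
  { apply ex_pseries_incr_1. now apply entire_ex_pseries. }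
  assert (X2 : ex_pseries (PS_scal (s + 1) d1) w).
  { apply ex_pseries_scal; [apply Rmult_comm | now apply entire_ex_pseries]. }
  rewrite <- PSeries_plus by assumption.
  rewrite <- PSeries_plus; [|now apply ex_pseries_plus | now apply entire_ex_pseries].
  rewrite <- (PSeries_const_0 w). apply PSeries_ext. intros k.
  pose proof (bessel_coeff_S s k) as E. fold c in E.
  destruct k as [|k].
  - change (0 + (s + 1) * (INR 1 * c 1%nat) + c 0%nat = 0). simpl INR in *. lra.
  - change (INR (S k) * (INR (S (S k)) * c (S (S k)))
            + (s + 1) * (INR (S (S k)) * c (S (S k))) + c (S k) = 0).
    rewrite !S_INR in *. lra.
Qed.

(** The equation is written as a first-order system solved for the second derivative, the form
    needed for [two_point_estimate] and for bootstrapping. The witness [f1] may be a limit of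
    derivatives. *)
Definition bessel_solution (nu : R) (f : R -> R) : Prop :=
  exists f1, forall z, 0 < z ->
    is_derive f z (f1 z) /\ is_derive f1 z (- / z * f1 z - (1 - nu ^ 2 * (/ z) ^ 2) * f z).

Lemma is_derive_Rpower_half s z :
  0 < z -> is_derive (fun t => Rpower (t / 2) s) z (s * / z * Rpower (z / 2) s).
Proof.
  intros Hz. unfold Rpower. auto_derive; [lra|]. change (z * / 2) with (z / 2). field. lra.
Qed.

Lemma BesselJ_solution nu : bessel_solution nu (BesselJ nu).
Proof.
  set (c := bessel_coeff nu). set (p := fun z => Rpower (z / 2) nu).
  set (f0 := PSeries c). set (f1 := PSeries (PS_derive c)).
  set (f2 := PSeries (PS_derive (PS_derive c))).
  assert (D0 : forall w, is_derive f0 w (f1 w))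
    by (intros; apply entire_is_derive, bessel_coeff_CV).
  assert (D1 : forall w, is_derive f1 w (f2 w))
    by (intros; apply entire_is_derive, entire_PS_derive, bessel_coeff_CV).
  assert (Dp : forall z, 0 < z -> is_derive p z (nu * / z * p z))
    by (intros; now apply is_derive_Rpower_half).
  exists (fun z => p z * (nu * / z * f0 ((z / 2) ^ 2) + z / 2 * f1 ((z / 2) ^ 2))).
  intros z Hz.
  assert (Dw : forall f f' : R -> R, (forall w, is_derive f w (f' w)) ->
     is_derive (fun t => f ((t / 2) ^ 2)) z (f' ((z / 2) ^ 2) * (z / 2))).
  { intros f f' Hf. apply (is_derive_Rcomp f (fun t => (t / 2) ^ 2)); [apply Hf|].
    auto_derive; [easy | field]. }
  split.
  - eapply is_derive_val.
    { apply (is_derive_Rmult p (fun t => f0 ((t / 2) ^ 2))); [now apply Dp | apply Dw, D0]. }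
    simpl. ring.
  - eapply is_derive_val.
    { apply (is_derive_Rmult p); [now apply Dp|].
      apply (is_derive_Rplus (fun t => nu * / t * f0 ((t / 2) ^ 2))).
      - apply (is_derive_Rmult (fun t => nu * / t) (fun t => f0 ((t / 2) ^ 2)));
          [|apply Dw, D0].
        instantiate (1 := nu * (- / z ^ 2)). auto_derive; [lra | field; lra].
      - apply (is_derive_Rmult (fun t => t / 2) (fun t => f1 ((t / 2) ^ 2)));
          [|apply Dw, D1].
        instantiate (1 := / 2). auto_derive; [easy | field]. }
    pose proof (bessel_series_ode nu ((z / 2) ^ 2)) as E.
    fold c f0 f1 f2 in E.
    change (BesselJ nu z) with (p z * f0 ((z / 2) ^ 2)).
    cbv beta. set (y0 := f0 _) in *. set (y1 := f1 _) in *. set (y2 := f2 _) in *.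
    replace y0 with (- ((z / 2) ^ 2 * y2 + (nu + 1) * y1)) by lra.
    field. lra.
Qed.

Lemma bessel_solution_lin nu a b f g :
  bessel_solution nu f -> bessel_solution nu g ->
  bessel_solution nu (fun z => a * f z + b * g z).
Proof.
  intros [f1 Hf] [g1 Hg]. exists (fun z => a * f1 z + b * g1 z). intros z Hz.
  destruct (Hf z Hz) as [F0 F1], (Hg z Hz) as [G0 G1]. split.
  - apply is_derive_Rplus; now apply is_derive_Rscal.
  - eapply is_derive_val.
    + apply is_derive_Rplus; apply is_derive_Rscal; eassumption.
    + ring.
Qed.

Lemma bessel_solution_ext nu f g :
  (forall z, 0 < z -> f z = g z) -> bessel_solution nu f -> bessel_solution nu g.
Proof.
  intros E [f1 Hf]. exists f1. intros z Hz. destruct (Hf z Hz) as [F0 F1].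
  rewrite <- E by exact Hz. split; [|exact F1].
  apply is_derive_ext_loc with f; [|exact F0].
  apply (filter_imp (fun t => 0 < t)); [exact E | now apply open_gt].
Qed.

Lemma bessel_solution_opp nu f : bessel_solution (- nu) f -> bessel_solution nu f.
Proof.
  intros [f1 Hf]. exists f1. intros z Hz. replace (nu ^ 2) with ((- nu) ^ 2) by ring.
  now apply Hf.
Qed.

(** Bootstrapping: the system expresses the derivatives of f and f1 by f, f1 and powers of [/ z], so
    both gain one order of smoothness together. *)
Lemma bessel_solution_smooth nu f n :
  bessel_solution nu f -> smooth_on (fun z => 0 < z) n f.
Proof.
  intros [f1 Hf]. set (D := fun z => 0 < z).
  assert (Hinv : forall n, smooth_on D n (fun z => / z)).
  { intros. apply smooth_on_inv. unfold D. intros; lra. }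
  enough (H : forall n, smooth_on D n f /\ smooth_on D n f1) by apply H.
  clear n. induction n as [|n [IH0 IH1]]; [easy|]. split.
  - exists f1. split; [intros; now apply Hf | exact IH1].
  - exists (fun z => (-1 * / z) * f1 z + (-1 + nu ^ 2 * (/ z * / z)) * f z). split.
    + intros z Hz. eapply is_derive_val; [apply Hf, Hz | ring].
    + apply smooth_on_plus; apply smooth_on_mult; auto.
      * now apply smooth_on_scal.
      * apply smooth_on_plus; [apply smooth_on_const|].
        now apply smooth_on_scal, smooth_on_mult.
Qed.

(** * Differentiability of J in its order *)

Lemma series_unif_cauchy (D : R -> Prop) (u : nat -> R -> R) (M : nat -> R) :
  (forall k x, D x -> Rabs (u k x) <= M k) -> ex_series M ->
  unif_cauchy D (fun n x => sum_n (fun k => u k x) n).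
Proof.
  intros Hu HM eps. destruct (Cauchy_ex_series M HM eps) as [N HN].
  assert (HW : forall n m x, (N <= m)%nat -> (m < n)%nat -> D x ->
     Rabs (sum_n (fun k => u k x) n - sum_n (fun k => u k x) m) <= eps).
  { intros n m x Hm Hn Hx.
    assert (E : sum_n_m (fun k => u k x) (S m) n
                = sum_n (fun k => u k x) n - sum_n (fun k => u k x) m)
      by (apply (sum_n_m_sum_n (fun k => u k x)); lia).
    rewrite <- E.
    eapply Rle_trans; [apply (norm_sum_n_m (fun k => u k x) (S m) n)|].
    eapply Rle_trans; [apply sum_n_m_le with (b := M); intros k; now apply Hu|].
    eapply Rle_trans; [apply Rle_abs|]. apply Rlt_le. apply (HN (S m) n); lia. }
  exists N. intros n m x Hn Hm Hx.
  destruct (Nat.lt_trichotomy n m) as [L | [-> | L]].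
  - rewrite Rabs_minus_sym. now apply HW.
  - rewrite Rminus_diag, Rabs_R0. apply Rlt_le, cond_pos.
  - now apply HW.
Qed.

Lemma is_derive_series (a b : R) (u du : nat -> R -> R) (M : nat -> R) x :
  (forall k y, a < y < b -> is_derive (u k) y (du k y)) ->
  (forall k y, a < y < b -> Rabs (du k y) <= M k) -> ex_series M ->
  (forall y, a < y < b -> ex_series (fun k => u k y)) ->
  a < x < b -> ex_derive (fun y => Series (fun k => u k y)) x.
Proof.
  intros Hd HM HS Hu Hx. eexists.
  apply (is_derive_lim a b (fun n y => sum_n (fun k => u k y) n)
           (fun n y => sum_n (fun k => du k y) n)); [| | |exact Hx].
  - intros n y Hy. apply (is_derive_sum_n u n y (fun k => du k y)). intros k _. now apply Hd.
  - now apply series_unif_cauchy with M.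
  - intros y Hy. exact (Series_correct _ (Hu y Hy)).
Qed.

Lemma is_derive_inv_rising k s :
  0 < s -> is_derive (fun y => / rising y k) s (- inv_sum s k * / rising s k).
Proof.
  intros Hs.
  apply is_derive_ext_loc with (fun y => exp (- log_rising y k)).
  - apply (filter_imp (fun t => 0 < t)); [|now apply open_gt].
    intros y Hy. now rewrite exp_Ropp, exp_log_rising.
  - pose proof (is_derive_log_rising s k Hs) as H.
    rewrite <- exp_log_rising, <- exp_Ropp by exact Hs.
    apply is_derive_val with (exp (- log_rising s k) * (-1 * inv_sum s k)); [|ring].
    apply (is_derive_Rcomp exp (fun y => - log_rising y k)).
    + apply is_derive_Reals, derivable_pt_lim_exp.
    + apply is_derive_ext with (fun y => -1 * log_rising y k); [intros; simpl; ring|].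
      now apply is_derive_Rscal.
Qed.

Lemma inv_rising_bounds k s : 1 <= s -> 0 < / rising s k <= 1.
Proof.
  intros Hs. assert (1 <= rising s k).
  { induction k as [|k IH]; simpl; [lra|]. pose proof (pos_INR k). nra. }
  split; [apply Rinv_0_lt_compat; lra|].
  rewrite <- Rinv_1. apply Rinv_le_contravar; lra.
Qed.

Lemma inv_sum_bounds k s : 1 <= s -> 0 <= inv_sum s k <= INR k.
Proof.
  intros Hs. induction k as [|k IH]; simpl inv_sum; rewrite ?S_INR; [simpl; lra|].
  pose proof (pos_INR k). split.
  - assert (0 < / (s + INR k)) by (apply Rinv_0_lt_compat; lra). lra.
  - assert (/ (s + INR k) <= 1) by (rewrite <- Rinv_1; apply Rinv_le_contravar; lra). lra.
Qed.

(* Only one value of [rGamma] is left on the right, so the terms of the series are elementary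
   functions of [s]. *)
Lemma bessel_tail N s w :
  0 < s + INR N + 1 ->
  PSeries (PS_decr_n (bessel_coeff s) N) w
  = rGamma (s + INR N + 1) *
    Series (fun k => (-1) ^ (N + k) / INR (fact (N + k)) * w ^ k
                     * / rising (s + INR N + 1) k).
Proof.
  intros Hs.
  rewrite <- Series_scal_l. apply Series_ext. intros k.
  unfold PS_decr_n, bessel_coeff. rewrite (rGamma_shift (s + INR N + 1) k), plus_INR.
  replace (s + (INR N + INR k) + 1) with (s + INR N + 1 + INR k) by ring.
  field. split; [apply Rgt_not_eq; now apply rising_pos | apply INR_fact_neq_0].
Qed.

(** For arguments above 1, [/ rising] is at most 1 and its logarithmic derivative at most k in
    absolute value, so the differentiated series is dominated by k |w|^k / k!, uniformly in the
    order. *)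
Lemma ex_derive_bessel_tail N w s :
  1 < s -> ex_derive (fun y => Series (fun k => (-1) ^ (N + k) / INR (fact (N + k)) * w ^ k
                     * / rising y k)) s.
Proof.
  intros Hs. set (b := fun k => (-1) ^ (N + k) / INR (fact (N + k)) * w ^ k).
  assert (Hb : forall k, Rabs (b k) <= / INR (fact k) * Rabs w ^ k).
  { intros k. unfold b, Rdiv.
    rewrite !Rabs_mult, pow_1_abs, Rmult_1_l, RPow_abs, Rabs_inv, (Rabs_pos_eq (INR _))
      by apply pos_INR.
    apply Rmult_le_compat_r; [apply Rabs_pos|].
    apply Rinv_le_contravar; [apply INR_fact_lt_0|]. apply le_INR, fact_le. lia. }
  assert (CV1 : CV_radius (fun k => / INR (fact k)) = p_infty).
  { apply entire_coeff_CV. exists 1. intros k. unfold Rdiv. rewrite Rmult_1_l.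
    rewrite Rabs_pos_eq; [apply Rle_refl | apply Rlt_le, Rinv_0_lt_compat, INR_fact_lt_0]. }
  assert (HM0 : ex_series (fun k => / INR (fact k) * Rabs w ^ k)) by now apply entire_ex_series.
  apply (is_derive_series 1 (s + 1) (fun k y => b k * / rising y k)
          (fun k y => b k * (- inv_sum y k * / rising y k))
          (fun k => INR k * (/ INR (fact k) * Rabs w ^ k))); [| | | |lra].
  - intros k y Hy. apply is_derive_Rscal, is_derive_inv_rising. lra.
  - intros k y Hy. rewrite !Rabs_mult, Rabs_Ropp, Rmult_comm.
    pose proof (inv_rising_bounds k y ltac:(lra)). pose proof (inv_sum_bounds k y ltac:(lra)).
    rewrite (Rabs_pos_eq (inv_sum y k)), (Rabs_pos_eq (/ rising y k)) by lra.
    apply Rmult_le_compat; [nra | apply Rabs_pos | nra | apply Hb].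
  (* The zeroth term vanishes; after the shift, k/k! = 1/(k - 1)! leaves [|w|] times the exponential
     series. *)
  - apply ex_series_incr_1.
    apply (ex_series_ext (fun k => scal (Rabs w) (/ INR (fact k) * Rabs w ^ k))).
    + intros k. change (Rabs w * (/ INR (fact k) * Rabs w ^ k)
        = INR (S k) * (/ INR (fact (S k)) * Rabs w ^ S k)).
      rewrite fact_simpl, mult_INR, <- tech_pow_Rmult. field.
      split; [apply INR_fact_neq_0 | rewrite S_INR; pose proof (pos_INR k); lra].
    + exact (ex_series_scal (Rabs w) (fun k => / INR (fact k) * Rabs w ^ k) HM0).
  - intros y Hy. 
    apply (@ex_series_le R_AbsRing R_CompleteNormedModule _
             (fun k => / INR (fact k) * Rabs w ^ k)); [|exact HM0].
    intros k. change (norm (b k * / rising y k)) with (Rabs (b k * / rising y k)).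
    pose proof (inv_rising_bounds k y ltac:(lra)).
    rewrite Rabs_mult, (Rabs_pos_eq (/ rising y k)), <- (Rmult_1_r (/ INR _ * _)) by lra.
    apply Rmult_le_compat; [apply Rabs_pos | lra | apply Hb | lra].
Qed.

(** Finitely many terms are split off, each differentiable because [rGamma] is; [bessel_tail]
    handles the rest. N exceeds [|s0| - 1], and the further step to [N1 = N + 1] makes [s + N1 + 1]
    positive for all [s > s0 - 1] and larger than 1 at s0. *)
Lemma ex_derive_BesselJ_order z s0 : ex_derive (fun s => BesselJ s z) s0.
Proof.
  destruct (nfloor_ex (Rabs s0) (Rabs_pos s0)) as (N & _ & HN).
  assert (Hs0 : 0 < s0 + INR N + 1).
  { pose proof (Rle_abs (- s0)) as K. rewrite Rabs_Ropp in K. lra. }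
  set (w := (z / 2) ^ 2). set (N1 := S N).
  apply ex_derive_ext_loc with (fun s => Rpower (z / 2) s *
    (sum_f_R0 (fun k => bessel_coeff s k * w ^ k) N + w ^ N1 * (rGamma (s + INR N1 + 1) *
      Series (fun k => (-1) ^ (N1 + k) / INR (fact (N1 + k)) * w ^ k
                     * / rising (s + INR N1 + 1) k)))).
  - apply (filter_imp (fun s => s0 - 1 < s)); [|apply open_gt; simpl; lra].
    intros s Hs. unfold BesselJ. fold w.
    change (fun k => (-1) ^ k * rGamma (s + INR k + 1) / INR (fact k)) with (bessel_coeff s).
    rewrite (PSeries_decr_n (bessel_coeff s) N w)
      by (apply entire_ex_pseries, bessel_coeff_CV).
    fold N1. rewrite bessel_tail; [reflexivity|]. unfold N1. rewrite S_INR. lra.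
  - apply @ex_derive_mult.
    + unfold Rpower. auto_derive. easy.
    + apply @ex_derive_plus.
      * induction N as [|N' IH'] in |- *; simpl.
        -- unfold bessel_coeff. auto_derive. apply ex_derive_rGamma.
        -- apply @ex_derive_plus; [exact IH'|].
           unfold bessel_coeff. auto_derive. apply ex_derive_rGamma.
      * apply ex_derive_scal. apply @ex_derive_mult.
        -- auto_derive. apply ex_derive_rGamma.
        -- apply (ex_derive_comp (fun y => Series (fun k => (-1) ^ (N1 + k)
              / INR (fact (N1 + k)) * w ^ k * / rising y k)) (fun s => s + INR N1 + 1)).
           ++ apply ex_derive_bessel_tail. unfold N1. rewrite S_INR. lra.
           ++ auto_derive. easy.
Qed.

(** * The Bessel function of the second kind *)

(** With q for the squared order, this is linear in the pair (f, f1) and affine in q, so the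
    difference of two solutions of different orders solves the equation up to a multiple of the
    difference of the q. *)
Definition bessel_rhs (q : R) (f f1 : R -> R) (z : R) : R :=
  - / z * f1 z - (1 - q * (/ z) ^ 2) * f z.

Lemma bessel_solution_Derive nu f z :
  bessel_solution nu f -> 0 < z ->
  is_derive f z (Derive f z) /\
  is_derive (Derive f) z (bessel_rhs (nu ^ 2) f (Derive f) z).
Proof.
  intros [f1 Hf] Hz.
  assert (E : forall t, 0 < t -> Derive f t = f1 t)
    by (intros t Ht; apply is_derive_unique, Hf, Ht).
  unfold bessel_rhs. rewrite E by exact Hz. destruct (Hf z Hz) as [F0 F1].
  split; [exact F0|].
  apply is_derive_ext_loc with f1; [|exact F1].
  apply (filter_imp (fun t => 0 < t)); [intros; symmetry; now apply E | now apply open_gt].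
Qed.

Lemma convergent_cauchy (u : nat -> R) (l : R) :
  is_lim_seq u l -> forall eps, 0 < eps -> exists N, forall n m, (N <= n)%nat -> (N <= m)%nat ->
    Rabs (u n - u m) <= eps.
Proof.
  intros Hu eps Heps.
  assert (H : ex_finite_lim_seq u) by now exists l.
  apply ex_lim_seq_cauchy_corr in H. destruct (H (mkposreal _ Heps)) as [N HN].
  exists N. intros. apply Rlt_le. now apply HN.
Qed.

Lemma convergent_bounded (u : nat -> R) (l : R) :
  is_lim_seq u l -> exists M, forall n, Rabs (u n) <= M.
Proof.
  intros Hu. destruct (filterlim_bounded u) as [M HM]; [now exists l | now exists M].
Qed.

Lemma bessel_rhs_bound (z0 z q Q : R) (f f1 : R -> R) :
  0 < z0 -> z0 / 2 <= z -> Rabs q <= Q ->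
  Rabs (bessel_rhs q f f1 z)
  <= (2 / z0 + Q * (2 / z0) ^ 2 + 1) * (Rabs (f z) + Rabs (f1 z)).
Proof.
  intros Hz0 Hz HQ. unfold bessel_rhs.
  pose proof (Rabs_pos (f z)) as P0. pose proof (Rabs_pos (f1 z)) as P1.
  pose proof (Rabs_pos q) as P2.
  assert (H1 : 0 < / z <= 2 / z0).
  { split; [apply Rinv_0_lt_compat; lra|].
    replace (2 / z0) with (/ (z0 / 2)) by (field; lra). apply Rinv_le_contravar; lra. }
  assert (H2 : 0 <= (/ z) ^ 2 <= (2 / z0) ^ 2).
  { split; [apply pow2_ge_0 | apply pow_incr; lra]. }
  assert (H3 : Rabs (1 - q * (/ z) ^ 2) <= 1 + Q * (2 / z0) ^ 2).
  { eapply Rle_trans; [apply Rabs_triang|]. rewrite Rabs_R1, Rabs_Ropp.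
    apply Rplus_le_compat_l. rewrite Rabs_mult, (Rabs_pos_eq ((/ z) ^ 2)) by lra.
    apply Rmult_le_compat; lra. }
  eapply Rle_trans; [apply Rabs_triang|].
  rewrite Rabs_Ropp, !Rabs_mult, Rabs_Ropp, (Rabs_pos_eq (/ z)) by lra.
  assert (/ z * Rabs (f1 z) <= 2 / z0 * Rabs (f1 z)) by (apply Rmult_le_compat_r; lra).
  assert (Rabs (1 - q * (/ z) ^ 2) * Rabs (f z) <= (1 + Q * (2 / z0) ^ 2) * Rabs (f z))
    by (apply Rmult_le_compat_r; lra).
  assert (0 <= (1 + Q * (2 / z0) ^ 2) * Rabs (f1 z)) by (apply Rmult_le_pos; nra).
  assert (0 <= 2 / z0 * Rabs (f z)) by (apply Rmult_le_pos; lra).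
  lra.
Qed.

Section SolutionLimit.

Variables (mu : nat -> R) (nu : R) (y : nat -> R -> R) (f : R -> R).
Hypothesis Hmu : is_lim_seq mu nu.
Hypothesis Hsol : forall k, bessel_solution (mu k) (y k).
Hypothesis Hlim : forall z, 0 < z -> is_lim_seq (fun k => y k z) (f z).

Let y1 k := Derive (y k).
Let y2 k := bessel_rhs (mu k ^ 2) (y k) (y1 k).

Lemma mu_sqr_lim : is_lim_seq (fun k => mu k ^ 2) (nu ^ 2).
Proof.
  apply is_lim_seq_ext with (fun k => mu k * mu k); [intros; ring|].
  replace (nu ^ 2) with (nu * nu) by ring. now apply is_lim_seq_mult'.
Qed.

(** The two-point estimate is used twice on a cell around z0: on each [y k], to bound them
    uniformly, and then on [y n - y m], whose equation has the extra term
    [(mu n ^ 2 - mu m ^ 2) y m / x^2], small by that bound. *)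
Lemma solutions_unif_cauchy z0 :
  0 < z0 -> exists a b, 0 < a < z0 /\ z0 < b /\
    unif_cauchy (fun x => a < x < b) y1 /\ unif_cauchy (fun x => a < x < b) y2.
Proof.
  intros Hz0.
  destruct (convergent_bounded _ _ mu_sqr_lim) as [Q HQ].
  assert (HQ0 : 0 <= Q) by (eapply Rle_trans; [apply Rabs_pos | apply (HQ 0%nat)]).
  set (K := 2 / z0 + Q * (2 / z0) ^ 2 + 1).
  assert (H2z : 0 < 2 / z0) by (apply Rdiv_lt_0_compat; lra).
  assert (HK : 1 <= K) by (unfold K; pose proof (pow2_ge_0 (2 / z0)); nra).
  (* [d <= z0] keeps the cell to the right of [z0 / 2], where the coefficients are bounded by K;
     [d K <= 1/4] together with [K >= 1] gives [d <= 1]. *)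
  set (d := Rmin z0 (/ (4 * K))).
  assert (HdK0 : 0 < / (4 * K)) by (apply Rinv_0_lt_compat; lra).
  assert (Hd0 : 0 < d) by (apply Rmin_pos; lra).
  assert (Hdz : d <= z0) by apply Rmin_l.
  assert (HdK : d * K <= 1 / 4).
  { apply Rle_trans with (/ (4 * K) * K); [|right; field; lra].
    apply Rmult_le_compat_r; [lra | apply Rmin_r]. }
  assert (Hd1 : 0 < d <= 1) by nra.
  set (c := z0 - d / 2).
  assert (Hcell : forall x, c <= x <= c + d -> z0 / 2 <= x) by (unfold c; intros; lra).
  assert (Hc : 0 < c) by (unfold c; lra).
  assert (D1 : forall k x, c <= x <= c + d -> is_derive (y k) x (y1 k x)).
  { intros k x Hx. apply (bessel_solution_Derive (mu k)); [apply Hsol | lra]. }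
  assert (D2 : forall k x, c <= x <= c + d -> is_derive (y1 k) x (y2 k x)).
  { intros k x Hx. apply (bessel_solution_Derive (mu k)); [apply Hsol | lra]. }
  destruct (convergent_bounded _ _ (Hlim c Hc)) as [B1 HB1].
  destruct (convergent_bounded _ _ (Hlim (c + d) ltac:(lra))) as [B2 HB2].
  set (L := 4 / d + 2).
  assert (HL : 2 < L) by (unfold L; pose proof (Rdiv_lt_0_compat 4 d ltac:(lra) Hd0); lra).
  set (B0 := Rmax B1 B2).
  assert (HB0 : 0 <= B0).
  { eapply Rle_trans; [apply Rabs_pos|]. eapply Rle_trans; [apply (HB1 0%nat) | apply Rmax_l]. }
  assert (Hbd : forall k x, c <= x <= c + d -> Rabs (y k x) <= L * B0).
  { intros k x Hx.
    apply (two_point_estimate (y k) (y1 k) (y2 k) c d K B0); auto; try lra.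
    - intros t Ht. eapply Rle_trans.
      + apply (bessel_rhs_bound z0 t _ Q); [exact Hz0 | now apply Hcell | apply HQ].
      + fold K. apply Rmult_le_compat_l; lra.
    - eapply Rle_trans; [apply HB1 | apply Rmax_l].
    - eapply Rle_trans; [apply HB2 | apply Rmax_r]. }
  assert (Hdiff : forall eta, 0 < eta -> exists N, forall n m, (N <= n)%nat -> (N <= m)%nat ->
     forall x, c <= x <= c + d ->
     Rabs (y2 n x - y2 m x) <= K * (eta + Rabs (y n x - y m x) + Rabs (y1 n x - y1 m x))
     /\ Rabs (y n c - y m c) <= eta /\ Rabs (y n (c + d) - y m (c + d)) <= eta).
  { intros eta Heta.
    assert (HG : 0 < (2 / z0) ^ 2 * (L * B0) + 1).
    { pose proof (pow2_ge_0 (2 / z0)).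
      assert (0 <= (2 / z0) ^ 2 * (L * B0))
        by (apply Rmult_le_pos; [lra | apply Rmult_le_pos; lra]). lra. }
    destruct (convergent_cauchy _ _ mu_sqr_lim (eta / ((2 / z0) ^ 2 * (L * B0) + 1)))
      as [N0 HN0]; [now apply Rdiv_lt_0_compat|].
    destruct (convergent_cauchy _ _ (Hlim c Hc) eta Heta) as [N1 HN1].
    destruct (convergent_cauchy _ _ (Hlim (c + d) ltac:(lra)) eta Heta) as [N2 HN2].
    exists (N0 + N1 + N2)%nat. intros n m Hn Hm x Hx.
    split; [|split; [apply HN1; lia | apply HN2; lia]].
    specialize (HN0 n m ltac:(lia) ltac:(lia)). cbv beta in HN0.
    pose proof (bessel_rhs_bound z0 x (mu n ^ 2) Q (fun t => y n t - y m t)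
      (fun t => y1 n t - y1 m t) Hz0 (Hcell x Hx) (HQ n)) as Hr. fold K in Hr. cbv beta in Hr.
    set (r := bessel_rhs _ _ _ _) in Hr.
    replace (y2 n x - y2 m x) with (r + (mu n ^ 2 - mu m ^ 2) * ((/ x) ^ 2 * y m x))
      by (unfold r, y2, bessel_rhs; ring).
    eapply Rle_trans; [apply Rabs_triang|].
    assert (Hq : Rabs ((mu n ^ 2 - mu m ^ 2) * ((/ x) ^ 2 * y m x)) <= eta).
    { specialize (Hcell x Hx).
      assert (H1 : 0 < / x <= 2 / z0).
      { split; [apply Rinv_0_lt_compat; lra|].
        replace (2 / z0) with (/ (z0 / 2)) by (field; lra). apply Rinv_le_contravar; lra. }
      rewrite !Rabs_mult, (Rabs_pos_eq ((/ x) ^ 2)) by apply pow2_ge_0.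
      apply Rle_trans with (eta / ((2 / z0) ^ 2 * (L * B0) + 1)
                            * ((2 / z0) ^ 2 * (L * B0) + 1)).
      - apply Rmult_le_compat; [apply Rabs_pos | | exact HN0 |].
        + apply Rmult_le_pos; [apply pow2_ge_0 | apply Rabs_pos].
        + apply Rle_trans with ((2 / z0) ^ 2 * (L * B0)); [|lra].
          apply Rmult_le_compat; [apply pow2_ge_0 | apply Rabs_pos | | now apply Hbd].
          apply pow_incr; lra.
      - right. set (G := (2 / z0) ^ 2 * (L * B0) + 1) in *. field. lra. }
    assert (eta <= K * eta) by nra. lra. }
  assert (Hfin : forall eps : posreal, exists N, forall n m x, (N <= n)%nat -> (N <= m)%nat ->
     c < x < c + d -> Rabs (y1 n x - y1 m x) <= eps /\ Rabs (y2 n x - y2 m x) <= eps).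
  (* The two-point estimate gives [L eta] for the first derivatives, hence [K (eta + L eta + L eta)]
     for the second; eps is the sum of the two. *)
  { intros eps. set (eta := eps / (L + K * (1 + 2 * L))).
    assert (HLK : 0 < L + K * (1 + 2 * L)) by nra.
    assert (Heta : 0 < eta) by (apply Rdiv_lt_0_compat; [apply cond_pos | exact HLK]).
    assert (Eeps : pos eps = L * eta + K * (1 + 2 * L) * eta) by (unfold eta; field; lra).
    destruct (Hdiff eta Heta) as [N HN]. exists N. intros n m x Hn Hm Hx.
    specialize (HN n m Hn Hm).
    destruct (two_point_estimate (fun t => y n t - y m t) (fun t => y1 n t - y1 m t)
      (fun t => y2 n t - y2 m t) c d K eta) with (x := x) as [E0 E1]; auto; try lra.
    - intros t Ht. apply @is_derive_minus; now apply D1.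
    - intros t Ht. apply @is_derive_minus; now apply D2.
    - intros t Ht. now apply HN.
    - apply (HN c). lra.
    - apply (HN c). lra.
    - destruct (HN x ltac:(lra)) as [E2 _]. fold L in E0, E1.
      assert (0 <= K * (1 + 2 * L) * eta) by (apply Rmult_le_pos; nra).
      assert (0 <= L * eta) by nra.
      split; [lra|]. eapply Rle_trans; [exact E2|].
      apply Rle_trans with (K * (eta + L * eta + L * eta)); [|lra].
      apply Rmult_le_compat_l; lra. }
  exists c, (c + d). repeat split; try (unfold c; lra).
  - intros eps. destruct (Hfin eps) as [N HN]. exists N. intros; now apply HN.
  - intros eps. destruct (Hfin eps) as [N HN]. exists N. intros; now apply HN.
Qed.

Lemma bessel_solution_lim : bessel_solution nu f.
Proof.
  set (f1 := fun z => real (Lim_seq (fun k => y1 k z))). exists f1.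
  intros z Hz. destruct (solutions_unif_cauchy z Hz) as (a & b & Ha & Hb & C1 & C2).
  assert (D1 : forall k x, a < x < b -> is_derive (y k) x (y1 k x)).
  { intros k x Hx. apply (bessel_solution_Derive (mu k)); [apply Hsol | lra]. }
  assert (D2 : forall k x, a < x < b -> is_derive (y1 k) x (y2 k x)).
  { intros k x Hx. apply (bessel_solution_Derive (mu k)); [apply Hsol | lra]. }
  assert (L1 : forall x, a < x < b -> is_lim_seq (fun k => y1 k x) (f1 x))
    by (intros; now apply (lim_derive_correct a b)).
  split.
  - apply (is_derive_lim a b y y1 D1 C1); [|lra]. intros x Hx. apply Hlim. lra.
  - eapply is_derive_val; [apply (is_derive_lim a b y1 y2 D2 C2 f1 L1); lra|].
    assert (E : is_lim_seq (fun k => y2 k z)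
                  (- / z * f1 z - (1 - nu ^ 2 * (/ z) ^ 2) * f z)).
    { unfold y2, bessel_rhs. apply is_lim_seq_minus'.
      - apply is_lim_seq_mult'; [apply is_lim_seq_const | apply L1; lra].
      - apply is_lim_seq_mult'; [|now apply Hlim].
        apply is_lim_seq_minus'; [apply is_lim_seq_const|].
        apply is_lim_seq_mult'; [apply mu_sqr_lim | apply is_lim_seq_const]. }
    now rewrite (is_lim_seq_unique _ _ E).
Qed.

End SolutionLimit.

Lemma cos_INR_PI n : cos (INR n * PI) = (-1) ^ n.
Proof.
  induction n as [|n IH]; [simpl; rewrite Rmult_0_l; apply cos_0|].
  rewrite S_INR, Rmult_plus_distr_r, Rmult_1_l, neg_cos, IH. simpl. ring.
Qed.

Lemma sin_INR_PI n : sin (INR n * PI) = 0.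
Proof. apply sin_eq_0_1. exists (Z.of_nat n). now rewrite <- INR_IZR_INZ. Qed.

(** 1/Gamma vanishes at 0, -1, -2, ..., so the first n coefficients of J_(-n) are zero; the factor
    (z/2)^(2n) then taken out turns (z/2)^(-n) into (z/2)^n. *)
Lemma BesselJ_opp_INR n z : 0 < z -> BesselJ (- INR n) z = (-1) ^ n * BesselJ (INR n) z.
Proof.
  intros Hz. unfold BesselJ.
  change (fun k => (-1) ^ k * rGamma (- INR n + INR k + 1) / INR (fact k))
    with (bessel_coeff (- INR n)).
  rewrite (PSeries_decr_n_aux (bessel_coeff (- INR n)) n).
  - rewrite Rpower_Ropp, Rpower_pow, <- pow_mult, Nat.mul_comm, pow_mult by lra.
    replace (PSeries (PS_decr_n (bessel_coeff (- INR n)) n) ((z / 2) ^ 2))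
      with ((-1) ^ n * PSeries (fun k => (-1) ^ k * rGamma (INR n + INR k + 1) / INR (fact k))
                        ((z / 2) ^ 2)).
    + field. apply pow_nonzero. lra.
    + rewrite <- PSeries_scal. apply PSeries_ext. intros k.
      unfold PS_scal, PS_decr_n, bessel_coeff, scal; simpl; unfold mult; simpl.
      rewrite plus_INR. replace (- INR n + (INR n + INR k) + 1) with (INR k + 1) by ring.
      rewrite <- plus_INR, !rGamma_INR, pow_add. field.
      split; apply INR_fact_neq_0.
  - intros k Hk. unfold bessel_coeff.
    replace (- INR n + INR k + 1) with (- INR (n - S k)).
    + rewrite rGamma_opp_INR. field. apply INR_fact_neq_0.
    + rewrite minus_INR, S_INR by lia. ring.
Qed.

Lemma difference_quotient_lim (f : R -> R) (x l : R) (e : nat -> R) :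
  is_derive f x l -> is_lim_seq e 0 -> (forall k, e k <> 0) ->
  is_lim_seq (fun k => (f (x + e k) - f x) / e k) l.
Proof.
  intros Hf He Hne. apply is_derive_Reals in Hf. apply is_lim_seq_spec. intros eps.
  destruct (Hf eps (cond_pos eps)) as [del Hdel].
  apply is_lim_seq_spec in He. destruct (He del) as [N HN]. exists N. intros n Hn.
  apply Hdel; [apply Hne|]. specialize (HN n Hn). now rewrite Rminus_0_r in HN.
Qed.

(** [Lim] at n is the limit along [Rbar_loc_seq], that is n + 1/(k + 1). Numerator and denominator
    both vanish at n and are differentiable there, so the quotient tends to the quotient of the
    derivatives, the lower one being PI (-1)^n. *)
Lemma BesselY_quotient_lim n z :
  0 < z -> ex_finite_lim_seq (fun k => BesselY_quotient (Rbar_loc_seq (INR n) k) z).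
Proof.
  intros Hz. set (e := fun k => / (INR k + 1)).
  assert (He0 : forall k, e k <> 0).
  { intros k. apply Rinv_neq_0_compat. pose proof (pos_INR k). lra. }
  assert (He : is_lim_seq e 0).
  { apply (is_lim_seq_inv (fun k => INR k + 1) p_infty); [|easy].
    apply is_lim_seq_ext with (fun k => INR (S k)); [apply S_INR|].
    apply (is_lim_seq_incr_1 INR), is_lim_seq_INR. }
  set (num := fun s => BesselJ s z * cos (s * PI) - BesselJ (- s) z).
  set (den := fun s => sin (s * PI)).
  assert (Hn : ex_derive num (INR n)).
  { apply @ex_derive_minus.
    - apply @ex_derive_mult; [apply ex_derive_BesselJ_order | auto_derive; easy].
    - apply (ex_derive_comp (fun s => BesselJ s z) Ropp);
        [apply ex_derive_BesselJ_order | auto_derive; easy]. }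
  destruct Hn as [ln Hn].
  assert (Hd : is_derive den (INR n) (PI * (-1) ^ n)).
  { unfold den. rewrite <- cos_INR_PI. auto_derive; [easy | ring]. }
  assert (Hnum0 : num (INR n) = 0).
  { unfold num. rewrite cos_INR_PI, BesselJ_opp_INR by exact Hz. ring. }
  assert (Hden0 : den (INR n) = 0) by apply sin_INR_PI.
  assert (HPI : PI * (-1) ^ n <> 0).
  { apply Rmult_integral_contrapositive. split; [apply PI_neq0 | apply pow_nonzero; lra]. }
  exists (ln / (PI * (-1) ^ n)).
  apply is_lim_seq_ext with (fun k => (num (INR n + e k) - num (INR n)) / e k /
                                      ((den (INR n + e k) - den (INR n)) / e k)).
  - intros k. rewrite Hnum0, Hden0, !Rminus_0_r.
    change (BesselY_quotient (Rbar_loc_seq (INR n) k) z)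
      with (num (INR n + e k) / den (INR n + e k)).
    unfold Rdiv. rewrite Rinv_mult, Rinv_inv.
    transitivity (num (INR n + e k) * / den (INR n + e k) * (/ e k * e k)); [ring|].
    rewrite Rinv_l by apply He0. ring.
  - apply is_lim_seq_div'; [| |exact HPI]; now apply difference_quotient_lim.
Qed.

(** For fixed order this is a linear combination of J_nu and J_(-nu), whatever constant
    [/ sin (nu * PI)] is. Integer orders are thus included with the default value of division by 0,
    which covers the first point n + 1 of [Rbar_loc_seq]. *)
Lemma BesselY_quotient_solution nu : bessel_solution nu (BesselY_quotient nu).
Proof.
  apply bessel_solution_ext with
    (fun z => cos (nu * PI) / sin (nu * PI) * BesselJ nu z
              + - / sin (nu * PI) * BesselJ (- nu) z).
  - intros z _. unfold BesselY_quotient, Rdiv. ring.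
  - apply bessel_solution_lin; [apply BesselJ_solution|].
    apply bessel_solution_opp, BesselJ_solution.
Qed.

Lemma BesselY_solution nu : 0 < nu -> bessel_solution nu (BesselY nu).
Proof.
  intros Hnu. unfold BesselY. destruct (Req_EM_T (sin (nu * PI)) 0) as [E | _].
  - assert (Hn : exists n, nu = INR n).
    { destruct (sin_eq_0_0 _ E) as [k Hk]. apply Rmult_eq_reg_r in Hk; [|apply PI_neq0].
      destruct (IZN k) as [n Hn]; [apply le_IZR; lra|].
      exists n. now rewrite INR_IZR_INZ, <- Hn. }
    destruct Hn as [n ->].
    apply (bessel_solution_lim (Rbar_loc_seq (INR n)) (INR n)
             (fun k => BesselY_quotient (Rbar_loc_seq (INR n) k))).
    + apply (is_lim_seq_Rbar_loc_seq (INR n)).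
    + intros k. apply BesselY_quotient_solution.
    + intros z Hz. apply Lim_seq_correct'. now apply BesselY_quotient_lim.
  - apply BesselY_quotient_solution.
Qed.

(** * Airy functions and the transition region *)

Lemma entire_of_ratio (a : nat -> R) :
  a 0%nat = 1 -> (forall k, 0 <= a k) -> (forall k, INR (S k) * a (S k) <= a k) ->
  CV_radius a = p_infty.
Proof.
  intros H0 Hpos HS. apply entire_coeff_CV. exists 1. intros k.
  rewrite Rabs_pos_eq by apply Hpos.
  induction k as [|k IH].
  - rewrite H0. simpl. lra.
  - rewrite fact_simpl, mult_INR. specialize (HS k).
    assert (Hk : 0 < INR (S k)) by (apply lt_0_INR; lia).
    apply Rmult_le_reg_l with (INR (S k)); [exact Hk|].
    replace (INR (S k) * (1 / (INR (S k) * INR (fact k)))) with (1 / INR (fact k)).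
    + lra.
    + field. split; [apply INR_fact_neq_0 | lra].
Qed.

Lemma fact_3S k : fact (3 * S k) = ((3 * k + 3) * (3 * k + 2) * (3 * k + 1) * fact (3 * k))%nat.
Proof.
  replace (3 * S k)%nat with (S (S (S (3 * k)))) by lia.
  rewrite !fact_simpl. ring.
Qed.

Lemma fact_3S_1 k :
  fact (3 * S k + 1) = ((3 * k + 4) * (3 * k + 3) * (3 * k + 2) * fact (3 * k + 1))%nat.
Proof.
  replace (3 * S k + 1)%nat with (S (S (S (3 * k + 1)))) by lia.
  rewrite !(fact_simpl (S _)), (fact_simpl (3 * k + 1)). ring.
Qed.

(** The factor 3 (1/3 + k) = 3k + 1 cancels in the ratio of consecutive coefficients and leaves
    1/((3k + 2)(3k + 3)); for [airy_g] it is 1/((3k + 3)(3k + 4)). *)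
Lemma airy_f_CV : CV_radius (fun k => 3 ^ k * rising (1 / 3) k / INR (fact (3 * k))) = p_infty.
Proof.
  apply entire_of_ratio.
  - simpl. field.
  - intros k. apply Rlt_le, Rdiv_lt_0_compat; [|apply INR_fact_lt_0].
    apply Rmult_lt_0_compat; [apply pow_lt; lra | apply rising_pos; lra].
  - intros k. set (p := 3 ^ k * rising (1 / 3) k / INR (fact (3 * k))).
    assert (Hp : 0 < p).
    { apply Rdiv_lt_0_compat; [|apply INR_fact_lt_0].
      apply Rmult_lt_0_compat; [apply pow_lt; lra | apply rising_pos; lra]. }
    pose proof (pos_INR k) as Hk.
    replace (INR (S k) * (3 ^ S k * rising (1 / 3) (S k) / INR (fact (3 * S k))))
      with (p * / (3 * (3 * INR k + 2))).
    + rewrite <- (Rmult_1_r p) at 2. apply Rmult_le_compat_l; [lra|].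
      rewrite <- Rinv_1. apply Rinv_le_contravar; lra.
    + unfold p. rewrite fact_3S, !mult_INR, !plus_INR, !mult_INR, S_INR.
      simpl rising. simpl pow.
      replace (INR 3) with 3 by (simpl; ring).
      replace (INR 2) with 2 by (simpl; ring). simpl (INR 1).
      field. repeat split; try lra. apply INR_fact_neq_0.
Qed.

Lemma airy_g_CV :
  CV_radius (fun k => 3 ^ k * rising (2 / 3) k / INR (fact (3 * k + 1))) = p_infty.
Proof.
  apply entire_of_ratio.
  - simpl. field.
  - intros k. apply Rlt_le, Rdiv_lt_0_compat; [|apply INR_fact_lt_0].
    apply Rmult_lt_0_compat; [apply pow_lt; lra | apply rising_pos; lra].
  - intros k. set (p := 3 ^ k * rising (2 / 3) k / INR (fact (3 * k + 1))).
    assert (Hp : 0 < p).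
    { apply Rdiv_lt_0_compat; [|apply INR_fact_lt_0].
      apply Rmult_lt_0_compat; [apply pow_lt; lra | apply rising_pos; lra]. }
    pose proof (pos_INR k) as Hk.
    replace (INR (S k) * (3 ^ S k * rising (2 / 3) (S k) / INR (fact (3 * S k + 1))))
      with (p * / (3 * (3 * INR k + 4))).
    + rewrite <- (Rmult_1_r p) at 2. apply Rmult_le_compat_l; [lra|].
      rewrite <- Rinv_1. apply Rinv_le_contravar; lra.
    + unfold p. rewrite fact_3S_1, !mult_INR, !plus_INR, !mult_INR, S_INR.
      replace (INR 4) with 4 by (simpl; ring). simpl rising. simpl pow.
      replace (INR 3) with 3 by (simpl; ring).
      replace (INR 2) with 2 by (simpl; ring). simpl (INR 1).
      field. repeat split; try lra. apply INR_fact_neq_0.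
Qed.

Lemma smooth_airy_f n : smooth_on everywhere n airy_f.
Proof.
  apply (smooth_on_comp everywhere everywhere n
    (PSeries (fun k => 3 ^ k * rising (1 / 3) k / INR (fact (3 * k)))) (fun x => x ^ 3)).
  - easy.
  - apply smooth_on_PSeries, airy_f_CV.
  - apply smooth_on_pow.
Qed.

Lemma smooth_airy_g n : smooth_on everywhere n airy_g.
Proof.
  apply smooth_on_mult; [apply smooth_on_id|].
  apply (smooth_on_comp everywhere everywhere n
    (PSeries (fun k => 3 ^ k * rising (2 / 3) k / INR (fact (3 * k + 1)))) (fun x => x ^ 3)).
  - easy.
  - apply smooth_on_PSeries, airy_g_CV.
  - apply smooth_on_pow.
Qed.

Lemma smooth_Ai n : smooth_on everywhere n Ai.
Proof.
  apply smooth_on_ext with (fun x => Rpower 3 (- (2 / 3)) * rGamma (2 / 3) * airy_f x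
    + - (Rpower 3 (- (1 / 3)) * rGamma (1 / 3)) * airy_g x).
  - apply open_true.
  - intros x _. unfold Ai. ring.
  - apply smooth_on_plus; apply smooth_on_scal; [apply smooth_airy_f | apply smooth_airy_g].
Qed.

Lemma smooth_Bi n : smooth_on everywhere n Bi.
Proof.
  apply smooth_on_scal, smooth_on_plus; apply smooth_on_scal;
    [apply smooth_airy_f | apply smooth_airy_g].
Qed.

Lemma smooth_polynomial n f : is_polynomial f -> smooth_on everywhere n f.
Proof.
  intros (m & c & E).
  apply smooth_on_ext with (fun x => sum_n (fun k => c k * x ^ k) m).
  - apply open_true.
  - intros; now rewrite E.
  - apply (smooth_on_sum everywhere n (fun k x => c k * x ^ k)).
    intros k. apply smooth_on_scal, smooth_on_pow.
Qed.

Lemma Derive_n_tower f a : (forall n, smooth_on everywhere n f) -> tower (Derive_n f) a.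
Proof.
  intros Hf j. apply (smooth_on_Derive_n everywhere (S j)); auto; [apply open_true | easy].
Qed.

Lemma Rpower_third_pow nu n : Rpower nu (INR n / 3) = Rpower nu (1 / 3) ^ n.
Proof.
  rewrite <- Rpower_pow by apply exp_pos. rewrite Rpower_mult. f_equal. field.
Qed.

Lemma Rpower_third_large M : Rbar_locally p_infty (fun nu => M < Rpower nu (1 / 3)).
Proof.
  exists ((Rabs M + 1) ^ 3). intros nu Hnu. pose proof (Rabs_pos M).
  apply Rlt_trans with (Rabs M + 1); [pose proof (Rle_abs M); lra|].
  assert (E : Rpower ((Rabs M + 1) ^ 3) (1 / 3) = Rabs M + 1).
  { rewrite <- Rpower_pow, Rpower_mult by lra.
    replace (INR 3 * (1 / 3)) with 1 by (simpl; field). apply Rpower_1. lra. }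
  rewrite <- E at 1. apply Rlt_Rpower_l; [lra|]. split; [apply pow_lt; lra | exact Hnu].
Qed.

(** The term of [Q_k] has the order of the term of [P_(k+1)], so N and M + 1 count terms on a common
    scale. *)
Lemma next_order_eq l N M :
  next_order l N M = INR (l + 1 + 2 * Nat.min N (S M)) / 3.
Proof.
  unfold next_order. destruct (Nat.le_ge_cases N (S M)) as [H | H].
  - rewrite Nat.min_l by exact H. apply Rmin_left.
    apply Rmult_le_compat_r; [lra|]. apply le_INR. lia.
  - rewrite Nat.min_r by exact H.
    replace (l + 1 + 2 * S M)%nat with (l + 3 + 2 * M)%nat by lia.
    apply Rmin_right. apply Rmult_le_compat_r; [lra|]. apply le_INR. lia.
Qed.

Lemma sum_lt_S f n : sum_lt f (S n) = sum_lt f n + f n.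
Proof. destruct n as [|n]; simpl; [rewrite sum_O; ring | now rewrite sum_Sn]. Qed.

Section Transition.

Variables (P Q : nat -> R -> R) (w : R -> R) (sgn : R) (B : R -> R -> R).
Hypothesis HP : forall k n, smooth_on everywhere n (P k).
Hypothesis HQ : forall k n, smooth_on everywhere n (Q k).
Hypothesis Hw : forall n, smooth_on everywhere n w.
Hypothesis HB : forall nu, 0 < nu -> bessel_solution nu (B nu).
Hypothesis Hpt : forall a0, transition_expansion P Q w sgn 0 (fun a => a = a0)
  (fun nu a => B nu (transition_point nu a)).

Let t (nu : R) : R := Rpower nu (1 / 3).
Let h (nu : R) : R := / t nu ^ 2.
(** One factor t normalises the leading term to order 1; the other j come from the chain rule, as
    the transition point has derivative t in [a]. *)
Let F (nu : R) (j : nat) (a : R) : R :=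
  t nu ^ S j * Derive_n (B nu) j (transition_point nu a).
Let p (k j : nat) (a : R) : R :=
  sgn * Rpower 2 (1 / 3) * Derive_n (fun x => P k x * w (- Rpower 2 (1 / 3) * x)) j a.
Let q (k j : nat) (a : R) : R :=
  sgn * Rpower 2 (2 / 3) * Derive_n (fun x => Q k x * Derive w (- Rpower 2 (1 / 3) * x)) j a.
(** The merged coefficient of h^k: P-term k and, since the Q-series carries one more factor h,
    Q-term k - 1. *)
Let g (k j : nat) (a : R) : R :=
  p k j a + match k with O => 0 | S k' => q k' j a end.

Lemma t_pos nu : 0 < t nu.
Proof. apply exp_pos. Qed.

Lemma h_pos nu : 0 < h nu.
Proof. apply Rinv_0_lt_compat, pow_lt, t_pos. Qed.

Lemma h_small eps : 0 < eps -> Rbar_locally p_infty (fun nu => h nu < eps).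
Proof.
  intros Heps. generalize (filter_and _ _ (Rpower_third_large 1) (Rpower_third_large (/ eps))).
  apply filter_imp. intros nu [H1 H2]. fold (t nu) in H1, H2.
  unfold h. rewrite <- (Rinv_inv eps). pose proof (Rinv_0_lt_compat _ Heps).
  assert (t nu < t nu ^ 2) by nra.
  apply Rinv_lt_contravar; [apply Rmult_lt_0_compat|]; lra.
Qed.

Lemma p_tower k a : tower (p k) a.
Proof.
  apply tower_scal, Derive_n_tower. intros n. apply smooth_on_mult; [apply HP|].
  apply (smooth_on_comp everywhere everywhere); [easy | apply Hw|].
  apply smooth_on_scal, smooth_on_id.
Qed.

Lemma q_tower k a : tower (q k) a.
Proof.
  apply tower_scal, Derive_n_tower. intros n. apply smooth_on_mult; [apply HQ|].
  apply (smooth_on_comp everywhere everywhere); [easy | apply smooth_on_Derive, Hw|].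
  apply smooth_on_scal, smooth_on_id.
Qed.

Lemma g_tower k a : tower (g k) a.
Proof.
  destruct k as [|k].
  - apply (tower_plus (p 0) (fun _ _ => 0)); [apply p_tower | apply tower_0].
  - apply (tower_plus (p (S k)) (q k)); [apply p_tower | apply q_tower].
Qed.

Lemma t_cube nu : 0 < nu -> t nu ^ 3 = nu.
Proof.
  intros Hnu. unfold t. rewrite <- Rpower_third_pow.
  replace (INR 3 / 3) with 1 by (simpl; field). now apply Rpower_1.
Qed.

Lemma transition_point_eq nu a : 0 < nu -> transition_point nu a = t nu ^ 3 * (1 + a * h nu).
Proof.
  intros Hnu. unfold transition_point, h. fold (t nu).
  pose proof (t_cube nu Hnu) as E.
  pose proof (t_pos nu). rewrite <- E at 1. field. lra.
Qed.

Lemma transition_point_pos A D :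
  Rbar_locally p_infty (fun nu => 0 < nu /\ forall a, A <= a <= D -> 0 < transition_point nu a).
Proof.
  set (X := Rabs A + Rabs D + 1).
  assert (HX : 0 < X) by (pose proof (Rabs_pos A); pose proof (Rabs_pos D); unfold X; lra).
  assert (H0 : Rbar_locally p_infty (fun nu => 0 < nu)) by (now exists 0).
  generalize (filter_and _ _ H0 (h_small (/ X) (Rinv_0_lt_compat _ HX))).
  apply filter_imp. intros nu [Hnu Hh]. split; [exact Hnu|]. intros a Ha.
  rewrite transition_point_eq by exact Hnu. apply Rmult_lt_0_compat; [apply pow_lt, t_pos|].
  pose proof (h_pos nu).
  assert (X * h nu < 1).
  { rewrite <- (Rinv_r X) by lra. apply Rmult_lt_compat_l; lra. }
  assert (- X <= a).
  { unfold X. pose proof (Rle_abs (- A)). rewrite Rabs_Ropp in *. pose proof (Rabs_pos D). lra. }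
  nra.
Qed.

Lemma F_tower A D : Rbar_locally p_infty (fun nu => forall a, A <= a <= D -> tower (F nu) a).
Proof.
  generalize (transition_point_pos A D). apply filter_imp. intros nu [Hnu Hz] a Ha j.
  apply is_derive_val with (t nu ^ S j * (Derive_n (B nu) (S j) (transition_point nu a) * t nu)).
  - apply is_derive_Rscal, (is_derive_Rcomp (Derive_n (B nu) j)).
    + apply (smooth_on_Derive_n (fun z => 0 < z) (S j)); [apply open_gt | | lia | now apply Hz].
      now apply (bessel_solution_smooth nu), HB.
    + unfold transition_point. fold (t nu). auto_derive; [easy | ring].
  - unfold F. simpl pow. ring.
Qed.

(** Put u = 1 + a h, so z = t^3 u and nu = t^3. Then z^2 - nu^2 = t^6 (u^2 - 1) and t^2 (u^2 - 1) =
    2 a + a^2 h, so dividing Bessel's equation by suitable powers of t leaves a polynomial in h. *)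
Lemma F_eq A D :
  Rbar_locally p_infty (fun nu => forall a, A <= a <= D -> bessel_op (h nu) (F nu) 0 a = 0).
Proof.
  generalize (transition_point_pos A D). apply filter_imp. intros nu [Hnu Hz] a Ha.
  specialize (Hz a Ha). rewrite bessel_op_eq. unfold F. simpl pred.
  change (Derive_n (B nu) 2) with (Derive (Derive (B nu))).
  change (Derive_n (B nu) 1) with (Derive (B nu)). change (Derive_n (B nu) 0) with (B nu).
  destruct (bessel_solution_Derive nu (B nu) _ (HB nu Hnu) Hz) as [_ H2].
  rewrite (is_derive_unique _ _ _ H2). unfold bessel_rhs.
  pose proof (t_cube nu Hnu) as En.
  rewrite transition_point_eq in * by exact Hnu.
  set (u := 1 + a * h nu) in *.
  set (b0 := B nu _). set (b1 := Derive (B nu) _).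
  pose proof (t_pos nu) as Ht. pose proof (h_pos nu) as Hh.
  assert (Hu : 0 < u).
  { apply Rmult_lt_reg_l with (t nu ^ 3); [now apply pow_lt | lra]. }
  replace (2 * a + a ^ 2 * h nu) with ((u ^ 2 - 1) * t nu ^ 2)
    by (unfold u, h; field; lra).
  replace (INR 0 ^ 2 * h nu ^ 2 + 2 * a + a ^ 2 * h nu) with ((u ^ 2 - 1) * t nu ^ 2)
    by (unfold u, h; simpl; field; lra).
  replace (nu ^ 2) with ((t nu ^ 3) ^ 2) by now rewrite En.
  change (INR 0) with 0. unfold h. field. lra.
Qed.

Lemma transition_sum_eq l N M nu a :
  sgn * transition_sum P Q w l N M nu a =
  / t nu ^ S l * (partial h p N nu l a + h nu * partial h q M nu l a).
Proof.
  assert (Hk : forall k, Rpower nu (- (2 * INR k / 3)) = h nu ^ k).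
  { intros k. rewrite Rpower_Ropp. unfold h. rewrite pow_inv, <- pow_mult. f_equal.
    unfold t. rewrite <- Rpower_third_pow. f_equal. rewrite mult_INR. simpl. field. }
  (* [partial] is read as a numerical sum, with dummy values for the derivative index and the point,
     to compare it with [sum_lt]. *)
  assert (HS : forall (u : nat -> R) c n, c * sum_lt (fun k => h nu ^ k * u k) n
            = partial h (fun k (_ : nat) (_ : R) => c * u k) n nu 0%nat 0).
  { intros u c n. induction n as [|n IH]; [simpl; ring|].
    rewrite sum_lt_S. simpl. rewrite <- IH. ring. }
  assert (HC : forall u n j x, partial h u n nu j x
            = partial h (fun k (_ : nat) (_ : R) => u k j x) n nu 0%nat 0).
  { intros u n j x. induction n as [|n IH]; [reflexivity|]. simpl. now rewrite IH. }
  rewrite (HC p), (HC q). unfold p, q. rewrite <- !HS. unfold transition_sum.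
  rewrite !Rpower_third_pow. fold (t nu).
  replace (l + 1)%nat with (S l) by lia. replace (l + 3)%nat with (S (S (S l))) by lia.
  pose proof (t_pos nu).
  assert (E : forall (u : nat -> R) n, sum_lt (fun k => Rpower nu (- (2 * INR k / 3)) * u k) n
              = sum_lt (fun k => h nu ^ k * u k) n).
  { intros u n. induction n as [|n IH]; [reflexivity|]. now rewrite !sum_lt_S, IH, Hk. }
  rewrite !E. unfold h at 4. simpl pow. field. split; [lra | apply pow_nonzero; lra].
Qed.

Lemma error_order_eq l N M nu :
  Rpower nu (- next_order l N M) = / t nu ^ S l * h nu ^ Nat.min N (S M).
Proof.
  rewrite next_order_eq, Rpower_Ropp, Rpower_third_pow. fold (t nu).
  unfold h. rewrite pow_inv, <- pow_mult, <- Rinv_mult, <- pow_add. do 2 f_equal. lia.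
Qed.

Lemma partial_g m nu j a :
  partial h g m nu j a = partial h p m nu j a + h nu * partial h q (pred m) nu j a.
Proof.
  induction m as [|[|m] IH].
  - simpl. ring.
  - simpl. unfold g. ring.
  - change (partial h g (S (S m)) nu j a)
      with (partial h g (S m) nu j a + h nu ^ S m * g (S m) j a).
    rewrite IH. unfold g. simpl. ring.
Qed.

(** Surplus terms beyond the common truncation are no larger than the error; s is 0 for the P-series
    and 1 for the delayed Q-series. *)
Lemma partial_tail (u : nat -> nat -> R -> R) (m s n N l : nat) (A D : R) :
  (forall k a, tower (u k) a) -> (n <= N)%nat -> (m <= n + s)%nat ->
  big_O (Rbar_locally p_infty) h m A D
    (fun nu a => h nu ^ s * (partial h u N nu l a - partial h u n nu l a)).
Proof.
  intros Hu Hn Hm. induction Hn as [|N Hn IH].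
  - exists 0. apply filter_forall. intros nu a _. rewrite Rminus_diag, Rmult_0_r, Rabs_R0. lra.
  - apply big_O_ext with (fun nu a => h nu ^ s * (partial h u N nu l a - partial h u n nu l a)
                                      + h nu ^ (s + N) * u N l a); [apply _| |].
    + apply filter_forall. intros nu a _. simpl. rewrite pow_add. ring.
    + apply big_O_plus; [apply _ | exact IH|].
      apply big_O_power_mult; [apply _ | now apply filter_forall, h_pos | apply h_small | lia |].
      intros a. exists (u N (S l) a). apply Hu.
Qed.

Lemma F_pointwise m a :
  big_O (Rbar_locally p_infty) h m a a (fun nu x => F nu 0%nat x - partial h g m nu 0%nat x).
Proof.
  (* m P-terms and m - 1 Q-terms make up exactly m merged terms, with error of order min(m, S (pred
     m)) = m, also at m = 0. *)
  destruct (Hpt a m (pred m)) as [C HC]. exists C. revert HC. apply filter_imp.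
  intros nu H x Hx. assert (E : x = a) by lra. specialize (H x E).
  rewrite transition_sum_eq, error_order_eq, <- partial_g in H.
  replace (Nat.min m (S (pred m))) with m in H by lia.
  pose proof (t_pos nu) as Ht. unfold F. simpl Derive_n.
  replace (t nu ^ 1 * B nu (transition_point nu x) - partial h g m nu 0 x)
    with (t nu * (B nu (transition_point nu x) - / t nu ^ 1 * partial h g m nu 0 x))
    by (field; lra).
  rewrite Rabs_mult, (Rabs_pos_eq (t nu)) by lra.
  replace (C * h nu ^ m) with (t nu * (C * (/ t nu ^ 1 * h nu ^ m))) by (field; lra).
  apply Rmult_le_compat_l; [lra | exact H].
Qed.

Lemma transition_expansion_uniform l K :
  compact K -> transition_expansion P Q w sgn l K
    (fun nu a => Derive_n (B nu) l (transition_point nu a)).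
Proof.
  intros HK N M. destruct (compact_P1 K HK) as (A & D & HAD).
  set (m := Nat.min N (S M)).
  assert (H : big_O (Rbar_locally p_infty) h m A D (fun nu a =>
     F nu l a - (partial h p N nu l a + h nu * partial h q M nu l a))).
  (* The merged series is cut at m = min(N, M + 1); the rest are P-terms m to N - 1 and Q-terms m -
     1 to M - 1 (from 0 if m = 0), all of order at least h^m. *)
  { apply big_O_ext with (fun nu a => remainder h F g m nu l a
      + (-1 * (h nu ^ 0 * (partial h p N nu l a - partial h p m nu l a))
         + -1 * (h nu ^ 1 * (partial h q M nu l a - partial h q (pred m) nu l a)))); [apply _| |].
    - apply filter_forall. intros nu a _. unfold remainder. rewrite partial_g. ring.
    - assert (Hneg : forall f, big_O (Rbar_locally p_infty) h m A D f ->
                big_O (Rbar_locally p_infty) h m A D (fun nu a => -1 * f nu a)).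
      { intros f [C HC]. exists C. revert HC. apply filter_imp. intros nu Hf a Ha.
        rewrite Rabs_mult, Rabs_m1, Rmult_1_l. now apply Hf. }
      apply big_O_plus; [apply _ | |apply big_O_plus; [apply _ | |]].
      + apply uniform_expansion; [apply _ | now apply filter_forall, h_pos | apply h_small
          | apply F_tower | apply F_eq | apply g_tower | apply F_pointwise].
      + apply Hneg, partial_tail; [apply p_tower | lia | lia].
      + apply Hneg, partial_tail; [apply q_tower | lia | lia]. }
  destruct H as [C HC]. exists C. revert HC. apply filter_imp. intros nu H a Ha.
  specialize (H a (HAD a Ha)). rewrite transition_sum_eq, error_order_eq. fold m.
  pose proof (pow_lt _ (S l) (t_pos nu)) as Ht. unfold F in H.
  apply Rmult_le_reg_l with (t nu ^ S l); [exact Ht|].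
  rewrite <- (Rabs_pos_eq (t nu ^ S l)) at 1 by lra. rewrite <- Rabs_mult.
  replace (t nu ^ S l * (C * (/ t nu ^ S l * h nu ^ m))) with (C * h nu ^ m)
    by (field; lra).
  replace (t nu ^ S l * (Derive_n (B nu) l (transition_point nu a)
      - / t nu ^ S l * (partial h p N nu l a + h nu * partial h q M nu l a)))
    with (t nu ^ S l * Derive_n (B nu) l (transition_point nu a)
      - (partial h p N nu l a + h nu * partial h q M nu l a)) by (field; lra).
  exact H.
Qed.

End Transition.

Theorem proposition2p9 (P Q : nat -> R -> R) (HPQ : transition_polynomials P Q)
    (l : nat) (K : R -> Prop) (HK : compact K) :
  transition_expansion P Q Ai 1 l K
    (fun nu a => Derive_n (BesselJ nu) l (transition_point nu a)) /\
  transition_expansion P Q Bi (-1) l K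
    (fun nu a => Derive_n (BesselY nu) l (transition_point nu a)).
Proof.
  destruct HPQ as (HP & HQ & _ & HJ & HY).
  split; apply transition_expansion_uniform; auto using smooth_polynomial, smooth_Ai,
    smooth_Bi, BesselJ_solution, BesselY_solution.
Qed.
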